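(* Let $k$ be a field and let $\Gamma$ be a finite simplicial complex with vertex set $V$, with enriched chain complex $\mathcal{E}=\mathcal{E}(\Gamma;k)$. Put $\mathcal{G}=\mathbf{D}(\mathbf{A}(\mathcal{E}[-1]))$ and $\mathcal{F}^\vee=\mathbf{A}(\mathcal{G})$. Then $\mathcal{F}^\vee$ is the (minimal free) resolution of the Stanley-Reisner ring $k[\Gamma]$ over $S$, and $\mathcal{G}$ is the (minimal free) resolution of the Stanley-Reisner ideal $I_{\Gamma^*}\subseteq S$ of the Alexander dual simplicial complex $\Gamma^*$.
   Context: Notation: $S=k[x_v:v\in V]$, graded by $\mathbf{N}^V$; all elements of $V$ are vertices of $\Gamma$. The Stanley-Reisner ring is $k[\Gamma]=S/I_\Gamma$ with $I_\Gamma$ generated by the square free monomials of the non-faces of $\Gamma$. The Alexander dual is $\Gamma^*=\{R\subseteq V: V\setminus R\notin\Gamma\}$. Enriched chain complex: for a face $f$ (including $f=\emptyset$, of dimension $-1$) let $m_f=\prod_{v\in f}x_v$. $\mathcal{E}_i=\bigoplus_{\dim f=i}Sf$ ($f$ in multidegree of $m_f$), with differential $f\mapsto\sum_{\dim f'=i-1}\epsilon(f',f)\frac{m_f}{m_{f'}}f'$, where $\epsilon$ is the $\{-1,0,1\}$-valued incidence function defining the augmented oriented chain complex of $\Gamma$. The chain complex $\mathcal{E}[-1]$ has $\mathcal{E}[-1]_i=\mathcal{E}_{i-1}$. A chain complex $\mathcal{P}_\cdot$ is also viewed as a cochain complex via $\mathcal{P}^{i}=\mathcal{P}_{-i}$.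 Square free modules: a subset $R\subseteq V$ is identified with its characteristic vector in $\mathbf{N}^V$. An $\mathbf{N}^V$-graded $S$-module $M$ is square free if multiplication $M_{\mathbf b}\xrightarrow{x_v}M_{\mathbf b+e_v}$ is bijective whenever $v$ lies in the support of $\mathbf b$. Its Alexander dual $M^*$ is the square free module with $(M^* )_R=\mathrm{Hom}_k(M_{V\setminus R},k)$, where $x_v:(M^* )_R\to(M^* )_{R\cup\{v\}}$ for $v\notin R$ is the dual of $x_v:M_{V\setminus(R\cup\{v\})}\to M_{V\setminus R}$. A free square free module is one of the form $\bigoplus_{R\subseteq V}S\otimes_kB_R$ with $B_R$ a vector space in multidegree $R$. Functors on bounded complexes of finitely generated free square free modules: $\omega_S=S(-\mathbf 1)$ is the free module with one generator in multidegree $(1,\dots,1)$; $\mathbf{D}(\mathcal{P}^\cdot)=\mathrm{Hom}_S(\mathcal{P}^\cdot,\omega_S)$, with term $\mathrm{Hom}_S(\mathcal{P}^{-i},\omega_S)$ in degree $i$; $\mathbf{A}(\mathcal{P}^\cdot)$ is the minimal free resolution of the Alexander dual complex $\mathcal{P}^{\cdot *}$ (with term $(\mathcal{P}^{-i})^*$ in degree $i$), i.e. a minimal complex $\mathcal{Q}^\cdot$ of free square free modules (differentials vanish after $k\otimes_S-$) with a morphism $\mathcal{Q}^\cdot\to\mathcal{P}^{\cdot *}$ inducing isomorphisms on cohomology. *)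

(* Defs.v *)
From HB Require Import structures.
From mathcomp Require Import all_boot all_order all_algebra ring_quotient.
From mathcomp Require Import boolp functions.
From mathcomp Require Import mpoly zify ring.

Set Implicit Arguments.
Unset Strict Implicit.
Unset Printing Implicit Defensive.

Import GRing.Theory.
Local Open Scope ring_scope.
Local Open Scope quotient_scope.

(* The vertex set is V = 'I_n, S = {mpoly k[n]} is k[x_v : v in V], and
   'X_{1..n} is N^V.  A subset R of V is identified with its characteristic
   vector [sq R]. *)
Definition sq n (R : {set 'I_n}) : 'X_{1..n} :=
  [multinom (i \in R : nat) | i < n].

Section Graded.
Variables (n : nat) (k : fieldType).
Local Notation S := {mpoly k[n]}.

Record is_grading (M : lmodType S) (gr : 'X_{1..n} -> M -> Prop) : Prop :=
  IsGrading {
    gr_0 : forall b, gr b 0;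
    gr_lin : forall b (a : k) u v,
      gr b u -> gr b v -> gr b (a%:MP *: u + v);
    gr_X : forall b c u, gr b u -> gr (c + b)%MM ('X_[c] *: u);
    gr_span : forall u, exists s : seq ('X_{1..n} * M),
      (forall x, x \in s -> gr x.1 x.2) /\ u = \sum_(x <- s) x.2;
    gr_indep : forall (s : seq 'X_{1..n}) (w : 'X_{1..n} -> M),
      uniq s -> (forall b, gr b (w b)) -> \sum_(b <- s) w b = 0 ->
      forall b, b \in s -> w b = 0
  }.

(* N^V-graded S-modules: [grade M b u] means that u lies in M_b. *)
Record gmod := GMod {
  gcar :> lmodType S;
  grade : 'X_{1..n} -> gcar -> Prop;
  gradeP : is_grading grade
}.

Definition sqfree (M : gmod) : Prop :=
  forall (b : 'X_{1..n}) (v : 'I_n), b v != 0%N ->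
  forall u : M, grade (U_(v) + b)%MM u ->
  exists! w : M, grade b w /\ 'X_v *: w = u.

(* Finitely generated free square free modules (+)_R S (x)_k B_R, B_R in
   multidegree R: a finite homogeneous S-basis in square free degrees. *)
Definition sqfree_basis (M : gmod) (I : finType) (deg : I -> {set 'I_n})
    (e : I -> M) : Prop :=
  (forall i, grade (sq (deg i)) (e i)) /\
  (forall u : M, exists! c : {ffun I -> S}, u = \sum_i c i *: e i).

Definition free_sqfree (M : gmod) : Prop :=
  exists (I : finType) (deg : I -> {set 'I_n}) (e : I -> M),
    sqfree_basis deg e.

(* Cochain complexes.  A differential is given between any two indices and
   vanishes unless the target index is the source index plus one. *)
Record gcomplex := GComplex {
  cterm :> int -> gmod;
  cdiff : forall i j : int, {linear cterm i -> cterm j};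
  cdiff_grade : forall i j b (u : cterm i), grade b u -> grade b (cdiff i j u);
  cdiff_shape : forall i j, j != i + 1 -> forall u, cdiff i j u = 0;
  cdiff_comp : forall i j l u, cdiff j l (cdiff i j u) = 0
}.

Record fsq_complex := FsqComplex {
  fsq_cx :> gcomplex;
  fsq_free : forall i, free_sqfree (fsq_cx i);
  fsq_bounded : exists N : nat, forall i : int, (N < `|i|)%N ->
    forall u : fsq_cx i, u = 0
}.

Record cmorphism (P Q : gcomplex) (phi : forall i, {linear P i -> Q i}) : Prop :=
  CMorphism {
    cmor_grade : forall i b (u : P i), grade b u -> grade b (phi i u);
    cmor_comm : forall i j (u : P i),
      phi j (cdiff P i j u) = cdiff Q i j (phi i u)
  }.

(* Injectivity and surjectivity of the maps induced on cohomology. *)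
Definition quasi_iso (P Q : gcomplex) (phi : forall i, {linear P i -> Q i}) :
    Prop :=
  forall i,
    (forall u : P i, cdiff P i (i + 1) u = 0 ->
       (exists y : Q (i - 1), phi i u = cdiff Q (i - 1) i y) ->
       exists x : P (i - 1), u = cdiff P (i - 1) i x) /\
    (forall y : Q i, cdiff Q i (i + 1) y = 0 ->
       exists (u : P i) (z : Q (i - 1)),
         cdiff P i (i + 1) u = 0 /\ y = phi i u + cdiff Q (i - 1) i z).

(* The differentials vanish after k (x)_S -, i.e. modulo (x_v : v in V). *)
Definition minimal (P : gcomplex) : Prop :=
  forall i j (u : P i), exists w : 'I_n -> P j,
    cdiff P i j u = \sum_v 'X_v *: w v.

Definition klinear_on (M : gmod) (b : 'X_{1..n}) (f : M -> k) : Prop :=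
  forall (a : k) u v, grade b u -> grade b v ->
    f (a%:MP *: u + v) = a * f u + f v.

(* N is the Alexander dual of M: the pairings identify N_R with
   Hom_k(M_{V \ R}, k) and multiplication by x_v on N with the dual of
   multiplication by x_v on M.  A square free module is determined by its
   components in square free degrees and the multiplications between them. *)
Record alexander_dual (M N : gmod) (pair : {set 'I_n} -> N -> M -> k) : Prop :=
  AlexanderDual {
    ad_sqfree : sqfree N;
    ad_linl : forall R (u : M), grade (sq (~: R)) u ->
      klinear_on (sq R) (fun x => pair R x u);
    ad_linr : forall R (x : N), grade (sq R) x ->
      klinear_on (sq (~: R)) (pair R x);
    ad_perfect : forall R (f : M -> k), klinear_on (sq (~: R)) f ->
      exists! x : N, grade (sq R) x /\
        forall u, grade (sq (~: R)) u -> pair R x u = f u;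
    ad_mul : forall (R : {set 'I_n}) v (x : N) (u : M), v \notin R ->
      grade (sq R) x -> grade (sq (~: (v |: R))) u ->
      pair (v |: R) ('X_v *: x) u = pair R x ('X_v *: u)
  }.

Record alexander_dual_complex (P N : gcomplex)
    (pair : forall i, {set 'I_n} -> N i -> P (- i) -> k) : Prop :=
  AlexanderDualComplex {
    adc_term : forall i, alexander_dual (pair i);
    adc_diff : forall i j R (x : N i) (u : P (- j)),
      grade (sq R) x -> grade (sq (~: R)) u ->
      pair j R (cdiff N i j x) u = pair i R x (cdiff P (- j) (- i) u)
  }.

(* [is_A P Q]: Q is (a model of) A(P), the minimal free resolution of the
   Alexander dual complex of P. *)
Definition is_A (P Q : fsq_complex) : Prop :=
  minimal Q /\
  exists (N : gcomplex) (pair : forall i, {set 'I_n} -> N i -> P (- i) -> k)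
         (phi : forall i, {linear Q i -> N i}),
    [/\ alexander_dual_complex pair, cmorphism phi & quasi_iso phi].

Definition minimal_free_resolution (P : fsq_complex) (M : gmod) : Prop :=
  minimal P /\
  (forall i : int, 0 < i -> forall u : P i, u = 0) /\
  (forall i : int, i < 0 -> forall u : P i, cdiff P i (i + 1) u = 0 ->
     exists w : P (i - 1), u = cdiff P (i - 1) i w) /\
  exists aug : {linear P 0 -> M},
    [/\ forall b (u : P 0), grade b u -> grade b (aug u),
        forall y : M, exists u : P 0, y = aug u
      & forall u : P 0, aug u = 0 <-> exists w : P (-1), u = cdiff P (-1) 0 w].

Section GradingTheory.
Variable M : gmod.
Implicit Types (b : 'X_{1..n}) (u v : M).

Lemma grade0 b : grade b (0 : M). Proof. exact: (gr_0 (gradeP M)). Qed.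

Lemma grade_lin b (a : k) u v :
  grade b u -> grade b v -> grade b (a%:MP *: u + v).
Proof. exact: (gr_lin (gradeP M)). Qed.

Lemma gradeD b u v : grade b u -> grade b v -> grade b (u + v).
Proof. by move=> hu hv; have := grade_lin 1 hu hv; rewrite scale1r. Qed.

Lemma gradeZ b (a : k) u : grade b u -> grade b (a%:MP *: u).
Proof. by move=> hu; have := grade_lin a hu (grade0 b); rewrite addr0. Qed.

Lemma gradeN b u : grade b u -> grade b (- u).
Proof. by move=> /(gradeZ (-1)); rewrite mpolyCN scaleN1r. Qed.

Lemma grade_sum b (I : Type) (s : seq I) (Q : pred I) (F : I -> M) :
  (forall i, Q i -> grade b (F i)) -> grade b (\sum_(i <- s | Q i) F i).
Proof.
move=> h; elim/big_rec: _ => [|i x Qi hx]; first exact: grade0.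
by apply: gradeD => //; apply: h.
Qed.

Lemma grade_monom b (a : k) c u :
  grade b u -> grade (c + b)%MM ((a *: 'X_[c]) *: u).
Proof.
by move=> hu; rewrite -mul_mpolyC -scalerA; apply/gradeZ/(gr_X (gradeP M)).
Qed.

End GradingTheory.

Section BasisTheory.
Variables (M : gmod) (I : finType) (deg : I -> {set 'I_n}) (e : I -> M).
Hypothesis eP : sqfree_basis deg e.

Lemma basis_inj (c c' : I -> S) :
  \sum_i c i *: e i = \sum_i c' i *: e i -> c =1 c'.
Proof.
move=> h i; have [f [hf uf]] := eP.2 (\sum_i c i *: e i).
have := uf [ffun i => c i]; have := uf [ffun i => c' i].
do 2 (move=> /(_ _)); move=> h1 h2.
have e1 : f = [ffun i => c' i].
  by apply: h1; rewrite h; apply: eq_bigr => j _; rewrite ffunE.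
have e2 : f = [ffun i => c i].
  by apply: h2; apply: eq_bigr => j _; rewrite ffunE.
by have := congr1 (fun g : {ffun I -> S} => g i) (etrans (esym e2) e1);
  rewrite !ffunE.
Qed.

Lemma basis_grade (c : I -> S) a :
  grade a (\sum_i c i *: e i) ->
  forall i m, m \in msupp (c i) -> (m + sq (deg i))%MM = a.
Proof.
set u := \sum_i c i *: e i => hu i m hm.
pose cb b j : S := \sum_(p <- msupp (c j) | (p + sq (deg j))%MM == b)
  (c j)@_p *: 'X_[p].
pose w b : M := \sum_j cb b j *: e j.
pose t := undup (a :: flatten
  [seq [seq (p + sq (deg j))%MM | p <- msupp (c j)] | j : I]).
have gw b : grade b (w b).
  apply: grade_sum => j _; rewrite /cb scaler_suml.
  apply: grade_sum => p /eqP <-.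
  exact/grade_monom/eP.1.
have tm j p : p \in msupp (c j) -> (p + sq (deg j))%MM \in t.
  move=> hp; rewrite mem_undup inE; apply/orP; right.
  apply/flattenP; exists [seq (p + sq (deg j))%MM | p <- msupp (c j)].
    by apply/mapP; exists j => //; rewrite mem_enum.
  by apply/mapP; exists p.
have ta : a \in t by rewrite mem_undup inE eqxx.
have ut : uniq t by exact: undup_uniq.
have sw : \sum_(b <- t) w b = u.
  rewrite exchange_big /=; apply: eq_bigr => j _.
  rewrite -scaler_suml; congr (_ *: _).
  rewrite /cb; under eq_bigr => b _ do rewrite big_mkcond.
  rewrite exchange_big /= [RHS]mpolyE.
  rewrite big_seq [RHS]big_seq; apply: eq_bigr => p hp.
  rewrite -big_mkcond -big_filter (_ : [seq _ <- t | _] = [:: (p + sq (deg j))%MM]) ?big_seq1 //.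
  have := filter_pred1_uniq ut (tm _ _ hp).
  by under eq_filter => x do rewrite /= eq_sym.
have h0 : forall b, b \in t -> w b - (if b == a then u else 0) = 0.
  apply: (gr_indep (gradeP M) ut (w := fun b => w b - if b == a then u else 0)).
- move=> b; case: eqP => [->|_]; last by rewrite subr0.
  by apply: gradeD => //; apply: gradeN.
- rewrite sumrB sw (bigD1_seq a) //= eqxx big1 ?addr0 ?subrr // => b.
  by move/negPf->.
have := h0 _ (tm _ _ hm); case: eqP => // _; rewrite subr0 => w0.
have := @basis_inj (cb (m + sq (deg i))%MM) (fun=> 0).
rewrite -/(w _) w0 big1 => [|j _]; last by rewrite scale0r.
move=> /(_ erefl i) /(congr1 (mcoeff m)) /eqP.
rewrite mcoeff0 raddf_sum /= big_mkcond (bigD1_seq m) ?msupp_uniq //= eqxx.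
rewrite mcoeffZ mcoeffX eqxx mulr1 big1 ?addr0 => [|p hp]; last first.
  by case: ifP => // _; rewrite mcoeffZ mcoeffX (negPf hp) mulr0.
by rewrite mcoeff_eq0 hm.
Qed.

End BasisTheory.

Section Constructions.

Definition spanned (M : lmodType S) (gr : 'X_{1..n} -> M -> Prop) (u : M) :=
  exists s : seq ('X_{1..n} * M),
    (forall x, x \in s -> gr x.1 x.2) /\ u = \sum_(x <- s) x.2.

Lemma spanned1 (M : lmodType S) (gr : 'X_{1..n} -> M -> Prop) b u :
  gr b u -> spanned gr u.
Proof.
move=> h; exists [:: (b, u)]; split; last by rewrite big_seq1.
by move=> x; rewrite inE => /eqP->.
Qed.

Lemma spanned_sum (M : lmodType S) (gr : 'X_{1..n} -> M -> Prop)
    (J : Type) (s : seq J) (F : J -> M) :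
  (forall j, spanned gr (F j)) -> spanned gr (\sum_(j <- s) F j).
Proof.
move=> h; elim: s => [|j s [t [ht e0]]].
  by exists [::]; split; rewrite ?big_nil // => x; rewrite in_nil.
have [t' [ht' e]] := h j; exists (t' ++ t); split.
  by move=> x; rewrite mem_cat => /orP[/ht'|/ht].
by rewrite big_cons big_cat /= -e e0.
Qed.

(* The grading of S(-R). *)
Definition twist_deg (R : {set 'I_n}) (b : 'X_{1..n}) (p : S^o) : Prop :=
  forall m, m \in msupp (p : S) -> (m + sq R)%MM = b.

Lemma twist_deg_monom R (a : k) m : twist_deg R (m + sq R)%MM (a *: 'X_[m] : S).
Proof. by move=> p /msuppZ_le; rewrite msuppX inE => /eqP->. Qed.

Lemma twist_indep R (J : eqType) (s : seq J) (d : J -> 'X_{1..n}) (w : J -> S^o) :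
  uniq s -> injective d -> (forall b, twist_deg R (d b) (w b)) ->
  \sum_(b <- s) w b = 0 -> forall b, b \in s -> w b = 0.
Proof.
move=> us di hw h0 b bs; apply/mpolyP => m; rewrite mcoeff0.
apply/eqP; case: (boolP (m \in msupp (w b : S))) => hm; last first.
  by rewrite mcoeff_eq0.
have := congr1 (mcoeff m) h0; rewrite mcoeff0 raddf_sum /= (bigD1_seq b) //=.
rewrite big1 ?addr0 => [->//|c hc]; apply/eqP; rewrite mcoeff_eq0.
apply: contra hc => hc; apply/eqP/di.
by rewrite -(hw _ _ hm) -(hw _ _ hc).
Qed.

Lemma twist_grading R : is_grading (twist_deg R).
Proof.
split=> [b m|b a u v hu hv m|b c u hu m|u|s w us hw].
- by rewrite msupp0.
- rewrite /= => /msuppD_le; rewrite mem_cat => /orP[|/hv//].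
  by rewrite [_%:MP *: _]mul_mpolyC => /msuppZ_le/hu.
- rewrite /= [_ *: u]mulrC (perm_mem (msuppMX _ _)) => /mapP[p /hu <- ->].
  by rewrite addmA.
- rewrite [u]mpolyE; apply: spanned_sum => m.
  exact/spanned1/twist_deg_monom.
- exact: (twist_indep (d := id)).
Qed.

(* S(-R), generated in multidegree R. *)
Definition twist R : gmod := GMod (twist_grading R).

Definition omegaS : gmod := twist setT.

(* The direct sum of the S(-deg i), i in I. *)
Section FreeModule.
Variables (I : finType) (deg : I -> {set 'I_n}).

Definition free_deg (b : 'X_{1..n}) (p : {ffun I -> S^o}) : Prop :=
  forall i, twist_deg (deg i) b (p i).

Definition free_gen (i : I) : {ffun I -> S^o} := [ffun j => (i == j)%:R : S].

Lemma free_genE (p : {ffun I -> S^o}) : p = \sum_i (p i : S) *: free_gen i.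
Proof.
apply/ffunP => j; rewrite sum_ffunE (bigD1 j) //= big1 => [|i /negPf ij].
  by rewrite !ffunE eqxx /= addr0 [RHS]mulr1.
by rewrite !ffunE ij [LHS]mulr0.
Qed.

Lemma free_grading : is_grading free_deg.
Proof.
split=> [b i|b a u v hu hv i|b c u hu i|u|s w us hw h0 b bs].
- by rewrite ffunE; apply: (gr_0 (twist_grading _)).
- by rewrite !ffunE; apply: (gr_lin (twist_grading _)); [apply: hu|apply: hv].
- by rewrite !ffunE; apply: (gr_X (twist_grading _)); apply: hu.
- rewrite [u]free_genE -big_enum; apply: spanned_sum => i.
  rewrite [u i]mpolyE scaler_suml; apply: spanned_sum => m.
  apply: (@spanned1 _ _ (m + sq (deg i))%MM) => j; rewrite !ffunE.
  have [<-|_] := eqVneq; last first.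
    by rewrite [_ *: _]mulr0; apply: (gr_0 (twist_grading _)).
  by rewrite [_ *: _]mulr1; apply: twist_deg_monom.
- apply/ffunP => i; rewrite ffunE.
  apply: (twist_indep (R := deg i) (d := id) (w := fun b => w b i)) bs => //.
    by move=> c; apply: hw.
  by rewrite -sum_ffunE h0 ffunE.
Qed.

Definition free_gmod : gmod := GMod free_grading.

Lemma free_gmod_free : free_sqfree free_gmod.
Proof.
exists I, deg, free_gen; split=> [i j|u].
  rewrite !ffunE => m; have [<-|_] := eqVneq; last by rewrite msupp0.
  by rewrite msupp1 inE => /eqP->; rewrite add0m.
exists u; split=> [|c ->]; first exact: free_genE.
apply/ffunP => j; rewrite sum_ffunE (bigD1 j) //= big1 => [|i /negPf ij].
  by rewrite !ffunE eqxx /= addr0 [LHS]mulr1.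
by rewrite !ffunE ij [LHS]mulr0.
Qed.

End FreeModule.

Section HomModule.
Variables M N : lmodType S.

Definition is_linear : {pred M -> N} := fun f => `[< linear f >].

Lemma is_linear_submod : submod_closed is_linear.
Proof.
split=> [|c f g /asboolP hf /asboolP hg]; apply/asboolP => a u v /=.
  by rewrite [RHS]addr0 [RHS]scaler0.
have E w : (c *: f + g) w = c *: f w + g w by [].
rewrite !E hf hg !scalerDr !scalerA [c * a]mulrC.
by rewrite addrACA.
Qed.

HB.instance Definition _ :=
  GRing.isSubmodClosed.Build S (M -> N) is_linear is_linear_submod.

Definition homS := {f : M -> N | f \in is_linear}.

HB.instance Definition _ := SubChoice.on homS.
HB.instance Definition _ := [SubChoice_isSubLmodule of homS by <:].

Definition homS_fun (f : homS) : M -> N := val f.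

Lemma homS_linear (f : homS) : linear (homS_fun f).
Proof. exact: (elimT (asboolP (linear (val f))) (valP f)). Qed.

HB.instance Definition _ (f : homS) :=
  GRing.isLinear.Build S M N _ (homS_fun f) (homS_linear f).

Definition homS_of (f : {linear M -> N}) : homS :=
  exist _ (f : M -> N) (asboolT (@linearP _ _ _ _ f)).

Lemma homSP (f g : homS) : homS_fun f =1 homS_fun g -> f = g.
Proof. by move=> h; apply/val_inj/funext. Qed.

Lemma homSE (f g : homS) a u :
  homS_fun (a *: f + g) u = a *: homS_fun f u + homS_fun g u.
Proof. by []. Qed.

Lemma homSZ (f : homS) a u : homS_fun (a *: f) u = a *: homS_fun f u.
Proof. by []. Qed.

Lemma homS_sumE (J : Type) (s : seq J) (F : J -> homS) u :
  homS_fun (\sum_(j <- s) F j) u = \sum_(j <- s) homS_fun (F j) u.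
Proof. by elim/big_rec2: _ => // j x y _ <-. Qed.

End HomModule.

Definition precomp (M N W : lmodType S) (phi : {linear M -> N}) (f : homS N W) :
  homS M W := homS_of (homS_fun f \o phi).

Lemma precomp_linear (M N W : lmodType S) (phi : {linear M -> N}) :
  linear (@precomp M N W phi).
Proof. by move=> a f g; apply/homSP. Qed.

HB.instance Definition _ (M N W : lmodType S) (phi : {linear M -> N}) :=
  GRing.isLinear.Build S (homS N W) (homS M W) _ (@precomp M N W phi)
    (@precomp_linear M N W phi).

(* Hom_S(M, omega_S), for M finitely generated free square free. *)
Section OmegaDual.
Variable M : gmod.
Hypothesis freeM : free_sqfree M.

Definition hom_deg (b : 'X_{1..n}) (f : homS M omegaS) : Prop :=
  forall a (u : M), grade a u -> grade (a + b)%MM (homS_fun f u).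

Section DualBasis.
Variables (I : finType) (deg : I -> {set 'I_n}) (e : I -> M).
Hypothesis eP : sqfree_basis deg e.

Definition coords (u : M) : {ffun I -> S} := projT1 (cid (eP.2 u)).

Lemma coordsE u : u = \sum_i coords u i *: e i.
Proof. by rewrite /coords; case: cid => c []. Qed.

Lemma coords_sum (c : I -> S) i : coords (\sum_i c i *: e i) i = c i.
Proof. by apply: (basis_inj eP); rewrite -coordsE. Qed.

Lemma coord_linear i : linear (fun u => coords u i : S^o).
Proof.
move=> a u v; rewrite {1}[u]coordsE {1}[v]coordsE scaler_sumr -big_split /=.
under eq_bigr => j _ do rewrite scalerA -scalerDl.
by rewrite (coords_sum (fun j => a * coords u j + coords v j)).
Qed.

Definition dual_gen (i : I) : homS M omegaS :=
  exist _ (fun u => coords u i : S^o) (asboolT (@coord_linear i)).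

Lemma dual_gen_fun i u : homS_fun (dual_gen i) u = coords u i.
Proof. by []. Qed.

Lemma dual_genE (f : homS M omegaS) :
  f = \sum_i (homS_fun f (e i) : S) *: dual_gen i.
Proof.
apply/homSP => u; rewrite homS_sumE {1}[u]coordsE linear_sum.
by apply: eq_bigr => i _; rewrite linearZ /=; apply: mulrC.
Qed.

Lemma coords_gen i j : coords (e j) i = (j == i)%:R.
Proof.
rewrite -(coords_sum (fun i => (j == i)%:R : S)); congr (coords _ i).
rewrite (bigD1 j) //= eqxx scale1r big1 ?addr0 // => l /negPf.
by rewrite eq_sym => ->; rewrite scale0r.
Qed.

Lemma dual_gen_deg i m (c : k) :
  hom_deg (m + sq (~: deg i))%MM ((c *: 'X_[m] : S) *: dual_gen i).
Proof.
move=> a u hu l.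
have -> : homS_fun ((c *: 'X_[m] : S) *: dual_gen i) u
  = c *: ('X_[m] * coords u i) by rewrite scalerAl.
move/msuppZ_le; rewrite mulrC (perm_mem (msuppMX _ _)) => /mapP[q hq ->].
rewrite {1}[u]coordsE in hu; rewrite -(basis_grade eP hu hq).
apply/mnmP => j; rewrite !mnmE !inE.
by case: (j \in deg i) => /=; lia.
Qed.

End DualBasis.

Lemma hom_grading : is_grading hom_deg.
Proof.
have [I [deg [e eP]]] := freeM.
split=> [b a u _|b c f g hf hg a u hu|b c f hf a u hu|f|s w us hw h0 b bs].
- exact: grade0.
- by rewrite homSE; apply: grade_lin; [apply: hf|apply: hg].
- rewrite -[_ *: f]addr0 homSE addr0 addmA [(a + c)%MM]addmC -addmA.
  by apply: (gr_X (gradeP omegaS)); apply: hf.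
- rewrite [f](dual_genE eP) -big_enum; apply: spanned_sum => i.
  rewrite [homS_fun f (e i)]mpolyE scaler_suml; apply: spanned_sum => m.
  exact/spanned1/dual_gen_deg.
- apply/homSP => u; rewrite {1}[u](coordsE eP) linear_sum /=.
  rewrite big1 // => i _; rewrite linearZ /=.
  suff -> : homS_fun (w b) (e i) = 0 by rewrite scaler0.
  apply: (twist_indep (R := setT) (d := fun b => (sq (deg i) + b)%MM)
    (w := fun b => homS_fun (w b) (e i)) us) bs => [c d|c|].
  + move=> /(congr1 (fun m => m - sq (deg i)))%MM.
    by rewrite ![(sq _ + _)%MM]addmC !addmK.
  + by apply: hw; apply: eP.1.
  + by rewrite -homS_sumE h0.
Qed.

Definition omega_dual : gmod := GMod hom_grading.

Lemma omega_dual_free : free_sqfree omega_dual.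
Proof.
have [I [deg [e eP]]] := freeM.
exists I, (fun i => ~: deg i), (dual_gen eP); split=> [i|f].
  have := @dual_gen_deg _ _ _ eP i 0%MM 1.
  by rewrite add0m mpolyX0 !scale1r.
exists [ffun i => homS_fun f (e i)]; split=> [|c ->].
  by rewrite {1}[f](dual_genE eP); apply: eq_bigr => i _; rewrite ffunE.
apply/ffunP => j; rewrite ffunE homS_sumE (bigD1 j) //= big1 => [|i ij].
  by rewrite homSZ dual_gen_fun coords_gen eqxx addr0 [LHS]mulr1.
by rewrite homSZ dual_gen_fun coords_gen eq_sym (negPf ij) [LHS]mulr0.
Qed.

End OmegaDual.

Section DFunctor.
Variable P : fsq_complex.

Definition D_term (i : int) : gmod := omega_dual (fsq_free P (- i)).

Definition D_diff (i j : int) : {linear D_term i -> D_term j} :=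
  precomp (cdiff P (- j) (- i)).

Lemma D_diffE i j (f : D_term i) u :
  homS_fun (D_diff i j f) u = homS_fun f (cdiff P (- j) (- i) u).
Proof. by []. Qed.

Lemma D_grade i j b (f : D_term i) : grade b f -> grade b (D_diff i j f).
Proof. by move=> hf a u hu; apply: hf; apply: cdiff_grade. Qed.

Lemma D_shape (i j : int) : j != i + 1 -> forall f, D_diff i j f = 0.
Proof.
move=> ij f; apply/homSP => u; rewrite D_diffE cdiff_shape ?linear0 //; lia.
Qed.

Lemma D_comp i j l f : D_diff j l (D_diff i j f) = 0.
Proof. by apply/homSP => u; rewrite !D_diffE cdiff_comp linear0. Qed.

Definition D_cx : gcomplex := GComplex D_grade D_shape D_comp.

Lemma D_free i : free_sqfree (D_cx i).
Proof. exact: omega_dual_free. Qed.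

Lemma D_bounded : exists N : nat, forall i : int, (N < `|i|)%N ->
  forall f : D_cx i, f = 0.
Proof.
have [N hN] := fsq_bounded P; exists N => i hi f; apply/homSP => u.
by rewrite (hN (- i) _ u) ?linear0 // abszN.
Qed.

(* D(P) = Hom_S(P, omega_S), with term Hom_S(P^{-i}, omega_S) in degree i. *)
Definition D : fsq_complex := FsqComplex D_free D_bounded.

End DFunctor.

(* P[-1] in chain indexing, i.e. P[-1]_i = P_{i-1}, where P^i = P_{-i}. *)
Section ChainShift.
Variable P : fsq_complex.

Lemma shift_shape (i j : int) : j != i + 1 ->
  forall u : P (i + 1), cdiff P (i + 1) (j + 1) u = 0.
Proof. by move=> ij u; apply: cdiff_shape; rewrite (inj_eq (addIr _)). Qed.

Definition chain_shift_cx : gcomplex :=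
  @GComplex (fun i => P (i + 1)) (fun i j => cdiff P (i + 1) (j + 1))
    (fun i j => @cdiff_grade P (i + 1) (j + 1)) shift_shape
    (fun i j l => @cdiff_comp P (i + 1) (j + 1) (l + 1)).

Lemma shift_bounded : exists N : nat, forall i : int, (N < `|i|)%N ->
  forall u : chain_shift_cx i, u = 0.
Proof.
have [N hN] := fsq_bounded P; exists N.+1 => i hi; apply: hN; lia.
Qed.

Definition chain_shift : fsq_complex :=
  @FsqComplex chain_shift_cx (fun i => fsq_free P (i + 1)) shift_bounded.

End ChainShift.
End Constructions.
End Graded.

Record scomplex n := SComplex {
  faces :> {set {set 'I_n}};
  facesP : forall f g : {set 'I_n}, f \in faces -> g \subset f -> g \in faces
}.

Section AlexanderDual.
Variables (n : nat) (G : scomplex n).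

Definition alexander_faces : {set {set 'I_n}} := [set R | ~: R \notin faces G].

Lemma alexander_facesP (f g : {set 'I_n}) :
  f \in alexander_faces -> g \subset f -> g \in alexander_faces.
Proof.
rewrite !inE => hf gf; apply: contra hf => hg.
by apply: facesP hg _; rewrite setCS.
Qed.

Definition alexander_complex : scomplex n := SComplex alexander_facesP.

End AlexanderDual.

Section Enriched.
Variables (n : nat) (k : fieldType) (G : scomplex n).
Local Notation S := {mpoly k[n]}.

(* The faces of dimension i (and cardinality i + 1), for i : int. *)
Definition face (i : int) : Type :=
  {f : {set 'I_n} | (f \in faces G) && (#|f|%:Z == i + 1)}.
HB.instance Definition _ i := Finite.on (face i).

Definition face_set i (f : face i) : {set 'I_n} := val f.

Lemma face_setP i (f : face i) :
  face_set f \in faces G /\ #|face_set f|%:Z = i + 1.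
Proof. by have /andP[fG /eqP] := valP f. Qed.

(* The incidence function of the augmented oriented chain complex, faces being
   oriented by the order of 'I_n. *)
Definition incidence (f' f : {set 'I_n}) : int :=
  \sum_(v in f | f' == f :\ v) (-1) ^+ #|[set w in f | (w < v)%N]|.

Definition echain (i : int) : gmod n k := free_gmod k (@face_set i).

(* m_f / m_f' is the monomial of exponent sq f - sq f'. *)
Definition ediff (i j : int) (p : echain i) : echain j :=
  [ffun f' : face j => \sum_(f : face i)
     (incidence (face_set f') (face_set f))%:~R * 'X_[sq (face_set f) - sq (face_set f')]
     * (p f : S)].

Lemma ediff_linear i j : linear (@ediff i j).
Proof.
move=> a p q; apply/ffunP => f'; rewrite !ffunE scaler_sumr -big_split /=.
apply: eq_bigr => f _; rewrite !ffunE mulrDr; congr (_ + _).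
by rewrite [a *: _ in RHS]/(a * _) mulrCA.
Qed.

HB.instance Definition _ i j :=
  GRing.isLinear.Build S (echain i) (echain j) _ (@ediff i j)
    (@ediff_linear i j).

Lemma incidence_sub f' f : incidence f' f != 0 ->
  f' \subset f /\ #|f| = #|f'|.+1.
Proof.
move=> h; have [v /andP[vf /eqP->]|h0] := pickP [pred v in f | f' == f :\ v].
  by rewrite subD1set (cardsD1 v f) vf.
by move: h; rewrite /incidence big1_seq ?eqxx // => v /andP[]; have := h0 v => /= ->.
Qed.

Lemma ediff_grade i j b (p : echain i) :
  grade b p -> grade b (ediff j p).
Proof.
move=> hp f'; rewrite ffunE; apply: (grade_sum (M := twist k (face_set f'))) => f _.
have [->|/incidence_sub[sff _]] := eqVneq (incidence (face_set f') (face_set f)) 0.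
  by rewrite !mul0r; apply: (grade0 (twist k (face_set f'))).
move=> m.
have -> : (incidence (face_set f') (face_set f))%:~R =
  ((incidence (face_set f') (face_set f))%:~R : k)%:MP_[n] by rewrite rmorph_int.
rewrite -mulrA mul_mpolyC => /msuppZ_le.
rewrite mulrC (perm_mem (msuppMX _ _)) => /mapP[q hq ->].
rewrite -(hp f q hq); apply/mnmP => x; rewrite !mnmE.
have := subsetP sff x; case: (x \in face_set f') => [->//|_]; case: (x \in face_set f); lia.
Qed.

Lemma incidence_comp (f'' f : {set 'I_n}) :
  \sum_(f' : {set 'I_n}) incidence f'' f' * incidence f' f = 0.
Proof.
pose s (g : {set 'I_n}) (v : 'I_n) : int :=
  (-1) ^+ #|[set w in g | (w < v)%N]|.
pose T v w : int := if [&& v \in f, w \in f, w != v & f'' == f :\ v :\ w]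
  then s (f :\ v) w * s f v else 0.
have s_lt (v w : 'I_n) : v \in f -> (v < w)%N -> s (f :\ v) w = - s f w.
  move=> vf vw; rewrite /s (cardsD1 v [set x in f | (x < w)%N]) !inE vf vw /=.
  rewrite add1n exprS mulN1r opprK; congr (_ ^+ #|pred_of_set _|).
  by apply/setP => x; rewrite !inE andbA.
have s_gt (v w : 'I_n) : (w < v)%N -> s (f :\ v) w = s f w.
  move=> wv; congr (_ ^+ #|pred_of_set _|); apply/setP => x; rewrite !inE.
  by case: eqP => //= ->; rewrite ltnNge (ltnW wv) andbF.
have TN (v w : 'I_n) : T w v = - T v w.
  rewrite /T (setDDl f) (setDDl f) (setUC [set w]) [w == v]eq_sym.
  rewrite [in LHS]andbCA.
  case: ifP => [/and4P[vf wf vw _]|]; last by rewrite oppr0.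
  have [vltw|wltv|/val_inj e] := ltngtP v w; last by rewrite e eqxx in vw.
    by rewrite (s_gt w v) // (s_lt v w) // mulNr opprK mulrC.
  by rewrite (s_lt w v) // (s_gt v w) // mulNr mulrC.
have -> : \sum_f' incidence f'' f' * incidence f' f = \sum_v \sum_w T v w.
  under eq_bigr => f' _ do rewrite {2}/incidence big_mkcond mulr_sumr.
  rewrite exchange_big /=; apply: eq_bigr => v _.
  rewrite (bigD1 (f :\ v)) //= eqxx andbT big1 ?addr0 => [|f' /negPf ->];
    last by rewrite andbF mulr0.
  rewrite /incidence big_mkcond mulr_suml; apply: eq_bigr => w _.
  rewrite /T !inE; case: (v \in f); last by rewrite mulr0.
  rewrite /= andbA [(w \in f) && _]andbC.
  by case: ifP => _; rewrite ?mul0r.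
set X := \sum_v _; have : X = - X.
  rewrite {1}/X exchange_big /= -sumrN; apply: eq_bigr => v _.
  by rewrite -sumrN; apply: eq_bigr => w _; apply: TN.
lia.
Qed.

Lemma incidence_face_comp i j (f'' : {set 'I_n}) (f : face i) :
  \sum_(f' : face j) incidence f'' (face_set f') * incidence (face_set f') (face_set f) = 0.
Proof.
have [fG fi] := face_setP f.
have [ij|ij] := eqVneq (j + 1) i; last first.
  rewrite big1 // => f' _; have [_ fj] := face_setP f'.
  have [->|/incidence_sub[_ cf]] := eqVneq (incidence (face_set f') (face_set f)) 0.
    by rewrite mulr0.
  move: ij fi fj cf; lia.
pose A := [pred f' : {set 'I_n} | (f' \in faces G) && (#|f'|%:Z == j + 1)].
rewrite -(big_sub A
  (fun f' => incidence f'' f' * incidence f' (face_set f))) /= big_mkcond /=.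
rewrite -[RHS](incidence_comp f'' (face_set f)); apply: eq_bigr => f' _.
case: ifPn => // /negP hA.
have [->|/incidence_sub[sf cf]] := eqVneq (incidence f' (face_set f)) 0.
  by rewrite mulr0.
case: hA; rewrite inE (facesP fG sf) ij /=.
by apply/eqP; move: fi; rewrite cf -addn1 PoszD => /addIr.
Qed.

Lemma ediff_comp i j l (p : echain i) :
  ediff l (ediff j p) = 0.
Proof.
apply/ffunP => f''; rewrite !ffunE.
under eq_bigr => f' _ do rewrite ffunE mulr_sumr.
rewrite exchange_big big1 //= => f _.
rewrite (eq_bigr (fun f' : face j => (incidence (face_set f'') (face_set f') *
  incidence (face_set f') (face_set f))%:~R * ('X_[sq (face_set f) - sq (face_set f'')] * p f))).
  by rewrite -mulr_suml -rmorph_sum incidence_face_comp mul0r.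
move=> f' _; rewrite rmorphM /=.
have [->|/incidence_sub[s1 _]] := eqVneq (incidence (face_set f'') (face_set f')) 0.
  by rewrite !mul0r.
have [->|/incidence_sub[s2 _]] := eqVneq (incidence (face_set f') (face_set f)) 0.
  by rewrite !(mul0r, mulr0).
have -> : (sq (face_set f) - sq (face_set f'')
  = (sq (face_set f') - sq (face_set f'')) + (sq (face_set f) - sq (face_set f')))%MM.
  apply/mnmP => x; rewrite !mnmE.
  have := subsetP s1 x; have := subsetP s2 x.
  case: (x \in face_set f); case: (x \in face_set f'); case: (x \in face_set f'') => h h' //.
  - by have := h' isT.
  - by have := h isT.
by rewrite mpolyXD; ring.
Qed.

Definition enriched_diff (i j : int) : {linear echain (- i) -> echain (- j)} :=
  @ediff (- i) (- j).

Lemma enriched_grade i j b (p : echain (- i)) :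
  grade b p -> grade b (enriched_diff i j p).
Proof. exact: ediff_grade. Qed.

Lemma enriched_shape (i j : int) : j != i + 1 -> forall p, enriched_diff i j p = 0.
Proof.
move=> ij p; apply/ffunP => f'; rewrite !ffunE big1 // => f _.
have [_ fi] := face_setP f; have [_ fj] := face_setP f'.
have [->|/incidence_sub[_ cf]] := eqVneq (incidence (face_set f') (face_set f)) 0.
  by rewrite !mul0r.
by exfalso; move: ij fi fj; rewrite cf; move: #|face_set f'| => c; lia.
Qed.

Lemma enriched_comp i j l p : enriched_diff j l (enriched_diff i j p) = 0.
Proof. exact: ediff_comp. Qed.

Definition enriched_cx : gcomplex n k :=
  GComplex enriched_grade enriched_shape enriched_comp.

Lemma enriched_free i : free_sqfree (enriched_cx i).
Proof. exact: free_gmod_free. Qed.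

Lemma enriched_bounded : exists N : nat, forall i : int, (N < `|i|)%N ->
  forall p : enriched_cx i, p = 0.
Proof.
exists n.+1 => i hi p; apply/ffunP => f.
have [_ fi] := face_setP f.
have := max_card (mem (face_set f)); rewrite card_ord => h.
by move: hi fi h; move: #|face_set f| => c; lia.
Qed.

(* The enriched chain complex, as a cochain complex: E^i = E_{-i}. *)
Definition enriched : fsq_complex n k :=
  FsqComplex enriched_free enriched_bounded.

End Enriched.

Section StanleyReisner.
Variables (n : nat) (k : fieldType) (G : scomplex n).
Local Notation S := {mpoly k[n]}.

(* The ideal I_G generated by the square free monomials of the non-faces. *)
Definition in_SR_ideal : {pred S^o} := fun p =>
  `[< exists c : {set 'I_n} -> S,
        p = \sum_(R : {set 'I_n} | R \notin faces G) c R * 'X_[sq R] >].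

Lemma in_SR_idealP p : reflect
  (exists c : {set 'I_n} -> S,
     p = \sum_(R : {set 'I_n} | R \notin faces G) c R * 'X_[sq R])
  (p \in in_SR_ideal).
Proof. exact: asboolP. Qed.

Lemma SR_ideal_submod : submod_closed in_SR_ideal.
Proof.
split=> [|a p q /in_SR_idealP[c ->] /in_SR_idealP[d ->]]; apply/in_SR_idealP.
  by exists (fun=> 0); rewrite big1 // => R _; rewrite mul0r.
exists (fun R => a * c R + d R); rewrite scaler_sumr -big_split /=.
by apply: eq_bigr => R _; rewrite mulrDl -mulrA.
Qed.

HB.instance Definition _ :=
  GRing.isSubmodClosed.Build S S^o in_SR_ideal SR_ideal_submod.

Lemma scalerAl_S (c : k) (p q : S) :
  (c *: p : S) *: (q : S^o) = c *: (p * q) :> S.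
Proof. by rewrite scalerAl. Qed.

Lemma SR_idealE (p : S^o) : p \in in_SR_ideal <->
  forall m, m \in msupp (p : S) ->
    exists2 R : {set 'I_n}, R \notin faces G & (sq R <= m)%MM.
Proof.
split=> [/in_SR_idealP[c ->] m|h].
  move=> /(msupp_sum_le (F := fun R : {set 'I_n} => c R * 'X_[sq R])).
  case/flatten_mapP=> R; rewrite mem_filter => /andP[RG _].
  rewrite (perm_mem (msuppMX _ _)) => /mapP[q _ ->]; exists R => //.
  exact: lem_addr.
rewrite [p]mpolyE big_seq; apply: rpred_sum => m /h[R RG Rm].
have -> : p@_m *: 'X_[m] = (p@_m *: 'X_[m - sq R] : S) *: ('X_[sq R] : S^o).
  by rewrite [RHS]scalerAl_S -mpolyXD submK.
apply: rpredZ; apply/in_SR_idealP; exists (fun R' => (R' == R)%:R).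
rewrite (bigD1 R) //= eqxx mul1r big1 ?addr0 // => R' /andP[_ /negPf->].
by rewrite mul0r.
Qed.

Definition SR_ideal_sub := {p : S^o | p \in in_SR_ideal}.
HB.instance Definition _ := SubChoice.on SR_ideal_sub.
HB.instance Definition _ := [SubChoice_isSubLmodule of SR_ideal_sub by <:].

(* Graded as a submodule of S = S(-0). *)
Definition SR_ideal_deg (b : 'X_{1..n}) (p : SR_ideal_sub) : Prop :=
  twist_deg set0 b (val p).

Lemma SR_ideal_grading : is_grading SR_ideal_deg.
Proof.
split=> [b|b a u v|b c u|u|s w us hw h0 b bs].
- exact: (gr_0 (twist_grading k set0)).
- exact: (gr_lin (twist_grading k set0)).
- exact: (gr_X (twist_grading k set0)).
- pose F m : SR_ideal_sub := insubd 0 ((val u : S)@_m *: 'X_[m] : S^o).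
  have FE m : m \in msupp (val u : S) -> val (F m) = (val u : S)@_m *: 'X_[m].
    move=> hm; rewrite insubdK //; apply/SR_idealE => m' /msuppZ_le.
    rewrite msuppX inE => /eqP->; exact: ((SR_idealE (val u)).1 (valP u)).
  have -> : u = \sum_(m <- msupp (val u : S)) F m.
    apply: val_inj; rewrite raddf_sum /= {1}[val u]mpolyE.
    by rewrite big_seq [RHS]big_seq; apply: eq_bigr => m /FE ->.
  apply: spanned_sum => m; apply: (@spanned1 _ _ _ _ (m + sq set0)%MM).
  rewrite /SR_ideal_deg val_insubd; case: ifP => _.
    exact: twist_deg_monom.
  exact: (gr_0 (twist_grading k set0)).
- apply: val_inj; rewrite linear0.
  apply: (gr_indep (twist_grading k set0) us (w := fun b => val (w b))) bs => //.
  by rewrite -raddf_sum h0 raddf0.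
Qed.

Definition SR_ideal : gmod n k := GMod SR_ideal_grading.

(* k[G] = S / I_G *)
Definition SR_quot := {ideal_quot in_SR_ideal}.
HB.instance Definition _ := GRing.Zmodule.on SR_quot.

Definition SR_pi (p : S^o) : SR_quot := \pi_({ideal_quot in_SR_ideal}) p.

Lemma SR_pi_eq p q : SR_pi p = SR_pi q <-> p - q \in in_SR_ideal.
Proof. by rewrite Quotient.idealrBE; split => /eqP. Qed.

Lemma SR_piD p q : SR_pi (p + q) = SR_pi p + SR_pi q.
Proof. exact: (raddfD \pi_({ideal_quot in_SR_ideal})). Qed.

Lemma SR_pi_repr (q : SR_quot) : SR_pi (repr q) = q.
Proof. exact: reprK. Qed.

Definition SR_scale (a : S) (q : SR_quot) : SR_quot := SR_pi (a *: (repr q : S^o)).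

Lemma SR_scale_pi a p : SR_scale a (SR_pi p) = SR_pi (a *: p).
Proof.
apply/SR_pi_eq; rewrite -scalerBr; apply: rpredZ.
by apply/SR_pi_eq; rewrite SR_pi_repr.
Qed.

Lemma SR_scaleA a b q : SR_scale a (SR_scale b q) = SR_scale (a * b) q.
Proof. by rewrite -[q]SR_pi_repr !SR_scale_pi scalerA. Qed.

Lemma SR_scale1 : left_id 1 SR_scale.
Proof. by move=> q; rewrite -[q]SR_pi_repr SR_scale_pi scale1r. Qed.

Lemma SR_scaleDr : right_distributive SR_scale +%R.
Proof.
move=> a p q; rewrite -[p]SR_pi_repr -[q]SR_pi_repr -SR_piD !SR_scale_pi.
by rewrite scalerDr SR_piD.
Qed.

Lemma SR_scaleDl q : {morph SR_scale^~ q : a b / a + b}.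
Proof.
by move=> a b; rewrite -[q]SR_pi_repr !SR_scale_pi scalerDl SR_piD.
Qed.

HB.instance Definition _ := GRing.Zmodule_isLmodule.Build S SR_quot
  SR_scaleA SR_scale1 SR_scaleDr SR_scaleDl.

Lemma SR_pi_linear : linear SR_pi.
Proof. by move=> a p q; rewrite SR_piD -SR_scale_pi. Qed.

HB.instance Definition _ :=
  GRing.isLinear.Build S S^o SR_quot _ SR_pi SR_pi_linear.

Definition SR_deg (b : 'X_{1..n}) (q : SR_quot) : Prop :=
  exists p : S^o, twist_deg set0 b p /\ q = SR_pi p.

Lemma SR_grading : is_grading SR_deg.
Proof.
split=> [b|b a _ _ [p [hp ->]] [q [hq ->]]|b c _ [p [hp ->]]|u|s w us hw h0 b bs].
- by exists 0; split; [exact: (gr_0 (twist_grading k set0))|rewrite linear0].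
- exists (a%:MP *: p + q); split; last by rewrite linearP.
  exact: (gr_lin (twist_grading k set0)).
- exists ('X_[c] *: p); split; last by rewrite linearZ.
  exact: (gr_X (twist_grading k set0)).
- rewrite -[u]SR_pi_repr [repr u]mpolyE linear_sum; apply: spanned_sum => m.
  apply: (@spanned1 _ _ _ _ (m + sq set0)%MM).
  exists ((repr u : S)@_m *: 'X_[m] : S); split=> //; exact: twist_deg_monom.
- have /choice[p hp] := hw.
  have sqE (m : 'X_{1..n}) : (m + sq set0)%MM = m.
    by apply/mnmP => i; rewrite !mnmE inE addn0.
  have pE c m : m \in msupp (p c : S) -> m = c.
    by move=> hm; rewrite -[m]sqE; apply: (hp c).1.
  rewrite (hp b).2 -(linear0 SR_pi); apply/SR_pi_eq; rewrite subr0.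
  have : \sum_(c <- s) p c \in in_SR_ideal.
    rewrite -[X in X \in _]subr0; apply/SR_pi_eq; rewrite linear0 linear_sum -[RHS]h0.
    by apply: eq_bigr => c _; rewrite (hp c).2.
  move=> /SR_idealE hs; apply/SR_idealE => m hm; apply: hs.
  rewrite mcoeff_msupp raddf_sum /= (bigD1_seq b) //= big1 ?addr0.
    by rewrite -mcoeff_msupp.
  move=> c cb; apply/eqP; rewrite mcoeff_eq0; apply: contra cb => hc.
  by rewrite -(pE _ _ hm) -(pE _ _ hc).
Qed.

Definition SR_ring : gmod n k := GMod SR_grading.

End StanleyReisner.

(* Main.v *)
(* Write P = E[-1].  The Alexander dual complex N = P^* has as its i-th term the
   sum of the S/(x_v : v in f) over the faces f with i elements.  Resolving each
   summand by its Koszul complex gives a free complex K quasi-isomorphic to N,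
   with a generator (g, h) of multidegree g in cohomological degree #|h| for all
   disjoint g, h with g u h a face.  A(E[-1]) and K are then homotopy equivalent,
   so D(A(E[-1])) and D(K) have the same cohomology.  For each vertex v there is
   a homotopy toggling v between g and h: on K together they show that K resolves
   N, and on D(K) they show that the cohomology is concentrated in degree 0,
   where evaluation at the cycle of all (-1)^#|f| x^(V \ f) (f, 0) identifies it
   with the ideal generated by the x^(V \ f), f a face, i.e. with the
   Stanley-Reisner ideal of the Alexander dual.  Nakayama's lemma turns exactness
   into vanishing for minimal complexes, which gives the second claim.  For the
   first one, the Alexander dual of a resolution of that ideal is exact except in
   degree 0, where its cocycles form a cyclic module with annihilator I_Gamma. *)
Require Import Defs.
From HB Require Import structures.
From mathcomp Require Import all_boot all_order all_algebra.
From mathcomp Require Import boolp functions.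
From mathcomp Require Import mpoly zify ring.

Set Implicit Arguments.
Unset Strict Implicit.
Unset Printing Implicit Defensive.

Import Order.TTheory GRing.Theory Num.Theory.
Local Open Scope ring_scope.

(** * Homogeneous components, division by variables and free modules *)

(** Three obstacles shape the argument. The dual complex [N] is not a chosen object: it is any
    complex paired perfectly with $\mathcal{E}[-1]$ in the square free degrees, so its generators
    have to be recovered from the pairing, as the functionals that read off the coefficient of
    $x^{V\setminus h}$ at a face $h$. Next, [D] respects homotopies but is not known to respect
    quasi-isomorphisms; this is why the free bounded complex $K$ is put between [Q] and [N], since
    maps out of such a complex lift through quasi-isomorphisms up to homotopy. The lifts are built
    on bases without regard to multidegrees, and homogeneity is restored afterwards by taking
    components. Finally, the toggling homotopies divide by $x_v$, so they are not $S$-linear. This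
    is harmless: they only serve to change one given cocycle by a coboundary, one vertex at a time,
    while divisibility conditions on its coefficients record the vertices already treated. The cycle
    used for evaluation has multidegree $(1,\dots,1)$, which makes evaluation of maps into
    $S(-\mathbf 1)$ preserve multidegrees. *)

Section HomogeneousComponents.
Variables (n : nat) (k : fieldType).
Local Notation S := {mpoly k[n]}.
Implicit Types (M : gmod n k) (b c : 'X_{1..n}).

Lemma hdecomp M (u : M) : exists (sw : seq 'X_{1..n} * ('X_{1..n} -> M)),
  [/\ forall b, grade b (sw.2 b), forall b, b \notin sw.1 -> sw.2 b = 0
    & u = \sum_(b <- undup sw.1) sw.2 b].
Proof.
have [t [ht ->]] := gr_span (gradeP M) u.
exists ([seq x.1 | x <- t], fun b => \sum_(x <- t | x.1 == b) x.2); split => /=.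
- move=> b; rewrite big_seq_cond; apply: grade_sum => x /andP[/ht + /eqP <-].
  exact.
- move=> b hb; rewrite big_seq_cond big1 // => x /andP[xt /eqP e].
  by case/negP: hb; rewrite -e map_f.
- under [RHS]eq_bigr => b _ do rewrite big_mkcond.
  rewrite exchange_big /= big_seq [RHS]big_seq; apply: eq_bigr => x xt.
  rewrite (bigD1_seq x.1) ?undup_uniq ?mem_undup ?map_f //=.
  by rewrite eqxx big1 ?addr0 // => b /negPf; rewrite eq_sym => ->.
Qed.

Lemma sum_undup_widen M (f : 'X_{1..n} -> M) (r t : seq 'X_{1..n}) :
  {subset r <= t} -> (forall c, c \notin r -> f c = 0) ->
  \sum_(c <- undup r) f c = \sum_(c <- undup t) f c.
Proof.
move=> rt fz; rewrite [RHS](bigID (fun c => c \in r)) /=.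
rewrite [X in _ + X]big1 ?addr0; last by move=> c /fz.
rewrite -[RHS]big_filter; apply: perm_big; apply: uniq_perm.
- exact: undup_uniq.
- exact/filter_uniq/undup_uniq.
- by move=> c; rewrite mem_filter !mem_undup; case: (boolP (c \in r)) => // /rt ->.
Qed.

(** The decomposition is picked by choice; by [gr_indep], [hcompP] shows that every other one has
    the same components. *)
Definition hcomp M b (u : M) : M := (projT1 (cid (hdecomp u))).2 b.

Lemma hcompP M (u : M) (s : seq 'X_{1..n}) (w : 'X_{1..n} -> M) :
  (forall b, grade b (w b)) -> (forall b, b \notin s -> w b = 0) ->
  u = \sum_(b <- undup s) w b -> forall b, hcomp b u = w b.
Proof.
rewrite /hcomp; case: cid => -[s' w'] /= [hw' z' e'] hw z e b.
pose t := undup (s ++ s').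
have [bt|bt] := boolP (b \in t); last first.
  move: bt; rewrite mem_undup mem_cat negb_or => /andP[h1 h2].
  by rewrite z // z'.
apply/eqP; rewrite -subr_eq0; apply/eqP.
apply: (gr_indep (gradeP M) (s := t) (w := fun c => w' c - w c)) bt.
- exact: undup_uniq.
- by move=> c; apply: gradeD => //; apply: gradeN.
- rewrite sumrB.
  rewrite -(@sum_undup_widen _ w' s'); last exact: z'.
    rewrite -(@sum_undup_widen _ w s); last exact: z.
      by rewrite -e -e' subrr.
    by move=> c cs; rewrite mem_cat cs.
  by move=> c cs; rewrite mem_cat cs orbT.
Qed.

Lemma grade_hcomp M b (u : M) : grade b (hcomp b u).
Proof. by rewrite /hcomp; case: cid => ? []. Qed.

Lemma hcomp_sum M (u : M) :
  exists s, (forall b, b \notin s -> hcomp b u = 0) /\ u = \sum_(b <- undup s) hcomp b u.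
Proof.
rewrite /hcomp; case: cid => -[s w] /= [_ h e]; by exists s.
Qed.

Lemma hcomp0P M (u : M) : (forall b, hcomp b u = 0) -> u = 0.
Proof. by move=> h; have [s [_ ->]] := hcomp_sum u; rewrite big1. Qed.

Lemma hcomp_morph M M' (f : {linear M -> M'}) :
  (forall b u, grade b u -> grade b (f u)) ->
  forall b u, hcomp b (f u) = f (hcomp b u).
Proof.
move=> hf b u; have [s [z e]] := hcomp_sum u.
apply: (@hcompP _ _ s (fun b => f (hcomp b u))) => [c|c /z ->|].
- exact/hf/grade_hcomp.
- exact: linear0.
- by rewrite {1}e linear_sum.
Qed.

Lemma hcomp_id M b c (u : M) : grade b u -> hcomp c u = if c == b then u else 0.
Proof.
move=> hu; apply: (@hcompP _ _ [:: b] (fun c => if c == b then u else 0)) => [d|d|].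
- by case: eqP => [->//|_]; apply: grade0.
- by rewrite inE => /negPf->.
- by rewrite /= big_seq1 eqxx.
Qed.

Lemma hcompD M b (u v : M) : hcomp b (u + v) = hcomp b u + hcomp b v.
Proof.
have [s [z e]] := hcomp_sum u; have [s' [z' e']] := hcomp_sum v.
apply: (@hcompP _ _ (s ++ s') (fun b => hcomp b u + hcomp b v)) => [c|c|].
- by apply: gradeD; apply: grade_hcomp.
- by rewrite mem_cat negb_or => /andP[/z -> /z' ->]; rewrite addr0.
- rewrite big_split /= {1}e {1}e'.
  congr (_ + _); apply: sum_undup_widen => // c cs; rewrite mem_cat cs ?orbT //.
Qed.

Lemma hcompB M b (u v : M) : hcomp b (u - v) = hcomp b u - hcomp b v.
Proof. by apply/eqP; rewrite eq_sym subr_eq -hcompD subrK. Qed.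

Lemma hcomp0 M b : hcomp b (0 : M) = 0.
Proof. by have := hcompB b (0 : M) 0; rewrite !subrr. Qed.

(** Replaces a preimage of a homogeneous element by a homogeneous one: exactness supplies arbitrary
    preimages, whereas Alexander duality only controls the graded ones. *)
Lemma hcomp_lift M M' (f : {linear M -> M'}) b (u : M) :
  (forall b u, grade b u -> grade b (f u)) -> grade b (f u) ->
  f (hcomp b u) = f u.
Proof. by move=> hf hu; rewrite -hcomp_morph // (hcomp_id _ hu) eqxx. Qed.

End HomogeneousComponents.

(** * Division by one variable *)

Section DivisionByVariables.
Variables (n : nat) (k : fieldType).
Local Notation S := {mpoly k[n]}.
Implicit Types (p q : S) (v w : 'I_n) (m : 'X_{1..n}).

Lemma mcoeffXM v p m :
  ('X_v * p)@_m = if m v == 0%N then 0 else p@_(m - U_(v)).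
Proof.
rewrite mulrC; case: eqVneq => [mv|mv].
  apply/eqP; rewrite mcoeff_eq0 (perm_mem (msuppMX _ _)).
  by apply/mapP => -[m' _ e]; move: mv; rewrite e !mnmE eqxx.
have {1}-> : m = (U_(v) + (m - U_(v)))%MM by rewrite addmC submK // lep1mP.
exact: mcoeffMX.
Qed.

(** Division with the remainder dropped. It commutes with multiplication by ['X_w] only for
    [w != v], so the homotopies built from it act on families of coefficients and are not declared
    as linear maps. *)
Definition divX v p : S := \sum_(m <- msupp p | m v != 0%N) p@_m *: 'X_[m - U_(v)].

Lemma mcoeff_divX v p m : (divX v p)@_m = p@_(U_(v) + m).
Proof.
rewrite /divX raddf_sum /=.
have h m' : m' v != 0%N -> ((m' - U_(v))%MM == m) = (m' == (U_(v) + m)%MM).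
  move=> hv; apply/eqP/eqP => [<-|->]; first by rewrite addmC submK // lep1mP.
  by rewrite addmC addmK.
rewrite (eq_bigr (fun m' => if m' == (U_(v) + m)%MM then p@_m' else 0)); last first.
  by move=> m' hv; rewrite mcoeffZ mcoeffX h //; case: eqP; rewrite ?mulr1 ?mulr0.
rewrite -big_mkcondr /=.
have [hm|hm] := boolP ((U_(v) + m)%MM \in msupp p); last first.
  rewrite big_seq_cond big1 => [|m' /and3P[hm' _ /eqP e]].
    by apply/esym/eqP; rewrite mcoeff_eq0.
  by rewrite -e hm' in hm.
rewrite big_mkcond (bigD1_seq (U_(v) + m)%MM) ?msupp_uniq //=.
rewrite eqxx !mnmE eqxx /= big1 ?addr0 // => m' /negPf->.
by rewrite andbF.
Qed.

Lemma divXM v p : divX v ('X_v * p) = p.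
Proof.
apply/mpolyP => m; rewrite mcoeff_divX mcoeffXM !mnmE eqxx /=.
by rewrite addmC addmK.
Qed.

Lemma divXMC v w p : v != w -> divX v ('X_w * p) = 'X_w * divX v p.
Proof.
move=> vw; apply/mpolyP => m; rewrite mcoeff_divX !mcoeffXM !mnmE (negPf vw) add0n.
case: eqVneq => // mw; rewrite mcoeff_divX addmBA // lep1mP //.
Qed.

Lemma divXD v p q : divX v (p + q) = divX v p + divX v q.
Proof. by apply/mpolyP => m; rewrite !(mcoeff_divX, mcoeffD). Qed.

Lemma divX0 v : divX v 0 = 0.
Proof. by apply/mpolyP => m; rewrite mcoeff_divX !mcoeff0. Qed.

Lemma divX_sum v (I : Type) (r : seq I) (P : pred I) (F : I -> S) :
  divX v (\sum_(i <- r | P i) F i) = \sum_(i <- r | P i) divX v (F i).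
Proof. exact: (big_morph _ (divXD v) (divX0 v)). Qed.

Lemma divX_sign v (b : nat) p : divX v ((-1) ^+ b * p) = (-1) ^+ b * divX v p.
Proof.
rewrite -signr_odd; case: (odd b); rewrite ?expr0 ?expr1 ?mul1r ?mulN1r //.
by apply/mpolyP => m; rewrite !(mcoeffN, mcoeff_divX).
Qed.

Lemma mcoeff_resX v p m :
  (p - 'X_v * divX v p)@_m = if m v == 0%N then p@_m else 0.
Proof.
rewrite mcoeffB mcoeffXM; case: eqVneq => mv; first by rewrite subr0.
by rewrite mcoeff_divX addmC submK ?subrr // lep1mP.
Qed.

End DivisionByVariables.

Section FreeModules.
Variables (n : nat) (k : fieldType).
Local Notation S := {mpoly k[n]}.

Lemma basis_lift (M : gmod n k) (I : finType) (deg : I -> {set 'I_n}) (e : I -> M)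
    (eP : sqfree_basis deg e) (L : lmodType S) (y : I -> L) :
  exists f : {linear M -> L}, forall i, f (e i) = y i.
Proof.
pose f u := \sum_i coords eP u i *: y i.
have fl : linear f.
  move=> a u v; rewrite /f scaler_sumr -big_split /=; apply: eq_bigr => i _.
  by have := coord_linear eP i a u v => /= ->; rewrite scalerDl scalerA.
pose F : {linear M -> L} := HB.pack f (GRing.isLinear.Build _ _ _ _ f fl).
exists F => i; rewrite /F /= /f (bigD1 i) //= coords_gen eqxx scale1r.
by rewrite big1 ?addr0 // => j /negPf; rewrite eq_sym coords_gen => ->; rewrite scale0r.
Qed.

Lemma basis_ext (M : gmod n k) (I : finType) (deg : I -> {set 'I_n}) (e : I -> M)
    (eP : sqfree_basis deg e) (L : lmodType S) (f g : {linear M -> L}) :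
  (forall i, f (e i) = g (e i)) -> f =1 g.
Proof.
move=> h u; rewrite [u](coordsE eP) !linear_sum; apply: eq_bigr => i _.
by rewrite !linearZ h.
Qed.

(** A basis element would have coordinate 1 along itself, but a combination of multiples of
    variables has coordinates without constant term; hence the basis is empty. *)
Lemma nakayama (M : gmod n k) : free_sqfree M ->
  (forall u : M, exists w : 'I_n -> M, u = \sum_v 'X_v *: w v) ->
  forall u : M, u = 0.
Proof.
move=> [I [deg [e eP]]] h u; rewrite [u](coordsE eP) big1 // => i _.
exfalso; have [w ew] := h (e i).
have : coords eP (e i) i = \sum_v 'X_v * coords eP (w v) i.
  pose g := dual_gen eP i; rewrite -!(dual_gen_fun eP) -/g {1}ew linear_sum /=.
  by apply: eq_bigr => v _; rewrite linearZ.
rewrite coords_gen eqxx => /(congr1 (mcoeff 0%MM)) /eqP.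
rewrite mcoeff1 eqxx raddf_sum /= big1 ?oner_eq0 // => v _.
by rewrite mcoeffXM mnmE eqxx.
Qed.

End FreeModules.

(** * Lifting through quasi-isomorphisms *)

Section Complexes.
Variables (n : nat) (k : fieldType).
Local Notation S := {mpoly k[n]}.
Implicit Types (P Q N : gcomplex n k).

(* Quantifying over all indices avoids transports along [i - 1 + 1 = i]; the
   differentials between non consecutive indices vanish. *)
Definition cocycle P i (u : P i) := forall j, cdiff P i j u = 0.
Definition coboundary P i (u : P i) := exists j (x : P j), u = cdiff P j i x.

Lemma cocycleP P i j (u : P i) : j = i + 1 -> cdiff P i j u = 0 -> cocycle u.
Proof.
move=> -> h l; have [->//|] := eqVneq l (i + 1).
by move=> /cdiff_shape ->.
Qed.

Lemma coboundaryP P i j (u : P i) : i = j + 1 -> coboundary u ->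
  exists x : P j, u = cdiff P j i x.
Proof.
move=> ij [l [x e]]; have [lj|lj] := eqVneq l j; first by subst l; exists x.
exists 0; rewrite linear0 e cdiff_shape // ij; apply: contra lj.
by rewrite (inj_eq (addIr _)) eq_sym.
Qed.

Lemma coboundary_cocycle P i (u : P i) : coboundary u -> cocycle u.
Proof. by move=> [j [x ->]] l; apply: cdiff_comp. Qed.

Lemma coboundary0 P i : coboundary (0 : P i).
Proof. by exists i, 0; rewrite linear0. Qed.

Lemma coboundaryD P i (u v : P i) : coboundary u -> coboundary v -> coboundary (u + v).
Proof.
have e : i = (i - 1) + 1 by rewrite subrK.
move=> /(coboundaryP e)[x ->] /(coboundaryP e)[y ->].
by exists (i - 1), (x + y); rewrite linearD.
Qed.

Lemma coboundaryN P i (u : P i) : coboundary u -> coboundary (- u).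
Proof. by move=> [j [x ->]]; exists j, (- x); rewrite linearN. Qed.

Lemma cocycleB P i (u v : P i) : cocycle u -> cocycle v -> cocycle (u - v).
Proof. by move=> hu hv j; rewrite linearB /= hu hv subr0. Qed.

Definition chain_map P Q (f : forall i, {linear P i -> Q i}) :=
  forall i j (u : P i), f j (cdiff P i j u) = cdiff Q i j (f i u).

Lemma chain_map_cocycle P Q (f : forall i, {linear P i -> Q i}) i (u : P i) :
  chain_map f -> cocycle u -> cocycle (f i u).
Proof. by move=> hf hu j; rewrite -hf hu linear0. Qed.

Lemma chain_map_coboundary P Q (f : forall i, {linear P i -> Q i}) i (u : P i) :
  chain_map f -> coboundary u -> coboundary (f i u).
Proof. by move=> hf [j [x ->]]; exists j, (f j x); rewrite hf. Qed.

Lemma quasi_isoP P Q (f : forall i, {linear P i -> Q i}) :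
  quasi_iso f <->
  forall i, (forall u : P i, cocycle u -> coboundary (f i u) -> coboundary u) /\
    (forall y : Q i, cocycle y -> exists2 u : P i, cocycle u & coboundary (y - f i u)).
Proof.
have e (i : int) : i = (i - 1) + 1 by rewrite subrK.
split=> h i; have [h1 h2] := h i; split.
- move=> u hu /(coboundaryP (e i)) [y hy].
  by have [|x ->] := h1 u (hu _); [exists y | exists (i - 1), x].
- move=> y hy; have [u [z [hu ey]]] := h2 y (hy _).
  exists u; first exact: cocycleP hu.
  by exists (i - 1), z; rewrite ey [f i u + _]addrC addrK.
- move=> u hu [y hy]; apply: coboundaryP (e i) _; apply: h1.
    exact: cocycleP hu.
  by exists (i - 1), y.
- move=> y hy; have [|u hu] := h2 y; first exact: cocycleP hy.
  move=> /(coboundaryP (e i)) [z hz]; exists u, z; split; first exact: hu.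
  by rewrite -hz addrC subrK.
Qed.

Definition homotopy_eq P Q (f g : forall i, {linear P i -> Q i}) :=
  exists s : forall i j, {linear P i -> Q j}, forall i (u : P i),
    f i u - g i u = cdiff Q (i - 1) i (s i (i - 1) u) + s (i + 1) i (cdiff P i (i + 1) u).

Lemma homotopy_eq_cocycle P Q (f g : forall i, {linear P i -> Q i}) i (u : P i) :
  homotopy_eq f g -> cocycle u -> coboundary (f i u - g i u).
Proof.
move=> [s hs] hu; rewrite hs hu linear0 addr0.
by exists (i - 1), (s i (i - 1) u).
Qed.

(* Descending induction on the cohomological index: over a basis element, the
   lift and the homotopy are corrected by means of the two halves of
   [quasi_iso phi]. *)
Lemma lift_through_quasi_iso (K : fsq_complex n k) Q N
    (phi : forall i, {linear Q i -> N i}) (psi : forall i, {linear K i -> N i}) :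
  chain_map phi -> quasi_iso phi -> chain_map psi ->
  exists2 beta : forall i, {linear K i -> Q i}, chain_map beta &
    homotopy_eq psi (fun i => phi i \o beta i : {linear K i -> N i}).
Proof.
move=> hphi /quasi_isoP qphi hpsi; have [B hB] := fsq_bounded K.
pose T i := ({linear K i -> Q i} * (forall j, {linear K i -> N j}))%type.
pose E (bs : forall i, T i) i := forall u : K i,
  cdiff Q i (i + 1) ((bs i).1 u) = (bs (i + 1)).1 (cdiff K i (i + 1) u) /\
  psi i u - phi i ((bs i).1 u) = cdiff N (i - 1) i ((bs i).2 (i - 1) u)
    + (bs (i + 1)).2 i (cdiff K i (i + 1) u).
have E0 bs i : (B < `|i|)%N -> E bs i.
  by move=> hi u; rewrite (hB i hi u); split; rewrite !linear0 ?subrr ?addr0.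
have inv m : exists bs, forall i, (B%:Z + 1 - m%:Z <= i) -> E bs i.
  elim: m => [|m [bs hbs]].
    by exists (fun i => (\0 : {linear _ -> _}, fun j => \0 : {linear _ -> _})) => i hi;
      apply: E0; lia.
  set i0 := B%:Z - m%:Z.
  have h1 : E bs (i0 + 1) by apply: hbs; rewrite /i0; lia.
  have [I [deg [e eP]]] := fsq_free K i0.
  have step l : exists qy : Q i0 * N (i0 - 1),
     cdiff Q i0 (i0 + 1) qy.1 = (bs (i0 + 1)).1 (cdiff K i0 (i0 + 1) (e l)) /\
     psi i0 (e l) - phi i0 qy.1 = cdiff N (i0 - 1) i0 qy.2
       + (bs (i0 + 1)).2 i0 (cdiff K i0 (i0 + 1) (e l)).
    set z := cdiff K i0 (i0 + 1) (e l).
    have ei : i0 + 1 - 1 = i0 by lia.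
    have [dz pz] := h1 z.
    rewrite cdiff_comp linear0 in dz; rewrite cdiff_comp linear0 addr0 ei in pz.
    have hz : coboundary (phi (i0 + 1) ((bs (i0 + 1)).1 z)).
      have -> : phi (i0 + 1) ((bs (i0 + 1)).1 z) =
         cdiff N i0 (i0 + 1) (psi i0 (e l) - (bs (i0 + 1)).2 i0 z).
        by rewrite linearB /= -hpsi -/z -pz opprB addrCA subrr addr0.
      by exists i0, (psi i0 (e l) - (bs (i0 + 1)).2 i0 z).
    have [q0 hq0] := coboundaryP erefl ((qphi (i0 + 1)).1 _ (cocycleP erefl dz) hz).
    (* [q0] only makes the lift commute with the differentials. The remaining error [y] is a
       cocycle, so it equals the image of a cocycle [q1] up to a coboundary, and the bounding
       element [y1] is the new value of the homotopy. *)
    pose y := psi i0 (e l) - (bs (i0 + 1)).2 i0 z - phi i0 q0.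
    have hy : cocycle y.
      apply: (cocycleP erefl); rewrite linearB /= -hphi -hq0 linearB /= -hpsi -/z -pz.
      by rewrite opprB addrCA subrr addr0 subrr.
    have [q1 hq1 hb] := (qphi i0).2 y hy.
    have [|y1 hy1] := coboundaryP (_ : i0 = (i0 - 1) + 1) hb; first by rewrite subrK.
    exists (q0 + q1, y1) => /=; split.
      by rewrite linearD /= -hq0 hq1 addr0.
    rewrite -hy1 /y linearD; apply: (canRL (subrK _)).
    have AC (V : zmodType) (a b c d : V) : a - (b + c) - d = a - d - b - c.
      by rewrite opprD addrA !(addrAC _ _ (- d)).
    exact: AC.
  have [qy hqy] := choice step.
  have [f hf] := basis_lift eP (fun l => (qy l).1).
  have [g hg] := basis_lift eP (fun l => (qy l).2).
  pose t : T i0 := (f, dfwith (fun j => \0 : {linear K i0 -> N j}) g).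
  exists (dfwith bs t) => i hi; have [->|ii0] := eqVneq i i0; last first.
    have hi1 : B%:Z + 1 - m%:Z <= i by move: ii0; rewrite /i0; lia.
    by rewrite /E !dfwith_out; [exact: hbs|move: hi1; rewrite /i0; lia..].
  rewrite /E dfwith_in dfwith_out; last by rewrite /i0; lia.
  rewrite /t /= dfwith_in => u; rewrite [u](coordsE eP).
  rewrite !linear_sum -!big_split /=; split; apply: eq_bigr => l _;
    rewrite !linearZ /= ?hf ?hg.
    by rewrite (hqy l).1.
  by rewrite -!scalerDr (hqy l).2.
(* Descending $2B+2$ steps from above $B$ passes below $-B$, where [E0] applies again. *)
have [bs hbs] := inv (B.+1 + B.+1)%N.
have hE i : E bs i.
  have [h|h] := lerP (B%:Z + 1 - (B.+1 + B.+1)%N%:Z) i; first exact: hbs.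
  by apply: E0; lia.
exists (fun i => (bs i).1); last by exists (fun i => (bs i).2) => i u; have [] := hE i u.
move=> i j u; have [->|ij] := eqVneq j (i + 1); first by have [] := hE i u.
by rewrite !cdiff_shape // linear0.
Qed.

(** Two out of three: on cohomology [psi] is the composite of [beta] and [phi]. *)
Lemma quasi_iso_cancel P Q N (phi : forall i, {linear Q i -> N i})
    (psi : forall i, {linear P i -> N i}) (beta : forall i, {linear P i -> Q i}) :
  chain_map phi -> chain_map psi -> chain_map beta -> quasi_iso phi -> quasi_iso psi ->
  homotopy_eq psi (fun i => phi i \o beta i : {linear P i -> N i}) ->
  quasi_iso beta.
Proof.
move=> cphi cpsi cbeta /quasi_isoP qphi /quasi_isoP qpsi hh; apply/quasi_isoP => i.
split=> [u hu hb|y hy].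
  apply: (qpsi i).1 => //.
  have := coboundaryD (homotopy_eq_cocycle hh hu) (chain_map_coboundary cphi hb).
  by rewrite subrK.
have [u hu hb] := (qpsi i).2 _ (chain_map_cocycle cphi hy); exists u => //.
apply: (qphi i).1; first exact/cocycleB/chain_map_cocycle.
have := coboundaryD hb (homotopy_eq_cocycle hh hu).
by rewrite addrA subrK linearB.
Qed.

(** Descending induction from the bound: if the term in degree $i+1$ vanishes, every element of
    degree $i$ is a cocycle, hence a coboundary, hence by minimality a combination of multiples of
    variables. *)
Lemma minimal_exact_pos (P : fsq_complex n k) :
  minimal P -> (forall i (u : P i), 0 < i -> cocycle u -> coboundary u) ->
  forall i, 0 < i -> forall u : P i, u = 0.
Proof.
move=> mP ex; have [B hB] := fsq_bounded P.
suff inv m : forall i, 0 < i -> B%:Z + 1 - m%:Z <= i -> forall u : P i, u = 0.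
  by move=> i i0; apply: (inv B.+1) => //; lia.
elim: m => [|m IH] i i0 hi; first by apply: hB; lia.
apply: nakayama (fsq_free P i) _ => u.
have hu : cocycle u.
  apply: (@cocycleP _ _ (i + 1)) => //.
  by apply: IH; lia.
have [j [x ->]] := ex i u i0 hu.
exact: mP.
Qed.

(** The witnesses of minimality are chosen on basis elements only, since the choice need not be
    linear; composed with [h] they extend to $S$-linear maps. *)
Lemma D_minimal (P : fsq_complex n k) : minimal P -> minimal (D P).
Proof.
move=> mP i j h; have [I [deg [e eP]]] := fsq_free P (- j).
have [w hw] := choice (fun l => mP (- j) (- i) (e l)).
have step v : exists f : {linear P (- j) -> omegaS n k},
    forall l, f (e l) = homS_fun h (w l v) by apply: basis_lift eP _ _.
have [f hf] := choice step.
exists (fun v => homS_of (f v)); apply: homSP; apply: (basis_ext eP) => l.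
rewrite /= D_diffE hw linear_sum homS_sumE; apply: eq_bigr => v _.
by rewrite linearZ homSZ /= hf.
Qed.

End Complexes.

(** * The complex of pairs of disjoint sets *)

Section PairComplex.
Variables (n : nat) (k : fieldType).
Local Notation S := {mpoly k[n]}.
Local Notation V := 'I_n.
Implicit Types (v w : 'I_n) (g h : {set 'I_n}) (F : {set 'I_n} -> {set 'I_n} -> S).

Definition eps v h : S := (-1) ^+ #|[set w in h | (w < v)%N]|.

Lemma epsK v h : eps v h * eps v h = 1.
Proof. by rewrite -expr2 sqrr_sign. Qed.

Lemma divX_eps v w h (p : S) : divX v (eps w h * p) = eps w h * divX v p.
Proof. exact: divX_sign. Qed.

Definition sg v w : S := if (v < w)%N then -1 else 1.

Lemma sgN v w : v != w -> sg v w = - sg w v.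
Proof.
move=> vw; rewrite /sg; case: ltngtP => [_|_|/val_inj e]; rewrite ?opprK //.
by rewrite e eqxx in vw.
Qed.

Lemma eps_add v w h : v \notin h -> eps w (v |: h) = sg v w * eps w h.
Proof.
move=> vh; rewrite /eps /sg; case: ifP => vw.
  rewrite -exprS; congr (_ ^+ _).
  rewrite (cardsD1 v) !inE eqxx vw add1n; congr (#|pred_of_set _|.+1).
  apply/setP => x; rewrite !inE; case: eqVneq => [->|//] /=.
  by rewrite (negPf vh).
rewrite mul1r; congr (_ ^+ #|pred_of_set _|); apply/setP => x; rewrite !inE.
by case: eqVneq => [->|//]; rewrite vw !andbF.
Qed.

Lemma sgK v w : sg v w * sg v w = 1.
Proof. by rewrite /sg; case: ifP; rewrite ?mulrNN mulr1. Qed.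

Lemma sgvv v : sg v v = 1.
Proof. by rewrite /sg ltnn. Qed.

Lemma eps_del v w h : v \in h -> eps w (h :\ v) = sg v w * eps w h.
Proof.
move=> vh; rewrite -[in RHS](setD1K vh) eps_add ?mulrA ?sgK ?mul1r //.
by rewrite !inE eqxx.
Qed.

(** The total differential on coefficients, $(g,h)$ being the Koszul generator $g$ over the face
    $g\cup h$. The first term is the Koszul differential, which keeps the face; the second enlarges
    the face by [v]. Both insert [v] into [h], so one sign depending on [h] alone serves for
    both. *)
Definition kD F g h : S :=
  \sum_(v in h) eps v h * ('X_v * F (v |: g) (h :\ v) + F g (h :\ v)).

(** A partial inverse of the Koszul differential in the direction [v]. *)
Definition ksig v F g h : S :=
  if v \in g then eps v h * divX v (F (g :\ v) (v |: h)) else 0.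

(** The transpose of [kD], acting on the values of a functional at the generators. For [v \notin g]
    the set [g :\ v] is [g], so both kinds of terms share one formula. *)
Definition kDs F g h : S :=
  \sum_(v | v \notin h) eps v h * ((if v \in g then 'X_v else 1) * F (g :\ v) (v |: h)).

Definition ktau v F g h : S :=
  if v \in h then eps v h * divX v (F (v |: g) (h :\ v)) else 0.

(** In characteristic 2 one cannot conclude from $X=-X$; the terms with $v<w$ are cancelled against
    those with $w<v$, and the diagonal has to vanish separately. *)
Lemma antisym_sum (T : V -> V -> S) :
  (forall v, T v v = 0) -> (forall v w, v != w -> T v w = - T w v) ->
  \sum_v \sum_w T v w = 0.
Proof.
move=> T0 TN.
have -> : \sum_v \sum_w T v w = \sum_(v : V) \sum_(w : V | (v < w)%N) T v w +
    \sum_(v : V) \sum_(w : V | (w < v)%N) T v w.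
  rewrite -big_split; apply: eq_bigr => v _ /=.
  rewrite (bigID (fun w : V => (v < w)%N)) /=; congr (_ + _).
  rewrite [RHS]big_mkcond [LHS]big_mkcond; apply: eq_bigr => w _.
  by case: ltngtP => // /val_inj ->; rewrite T0.
rewrite [X in _ + X](exchange_big_dep predT) //= -big_split big1 //= => v _.
rewrite -big_split big1 // => w vw /=.
by rewrite [T w v]TN ?subrr // neq_ltn vw orbT.
Qed.

Lemma kDD F g h : kD (kD F) g h = 0.
Proof.
pose T v w : S := if [&& v \in h, w \in h & w != v] then
  eps v h * (eps w (h :\ v) * ('X_v * ('X_w * F (w |: (v |: g)) (h :\ v :\ w) +
    F (v |: g) (h :\ v :\ w)) + ('X_w * F (w |: g) (h :\ v :\ w) + F g (h :\ v :\ w))))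
  else 0.
rewrite -[RHS](@antisym_sum T) => [|v|v w vw]; last first.
- rewrite /T [w == v]eq_sym vw !andbT [(w \in h) && _]andbC.
  case: ifP => [/andP[vh wh]|]; last by rewrite oppr0.
  have -> : h :\ w :\ v = h :\ v :\ w by rewrite !setDDl setUC.
  by rewrite !eps_del // [sg v w]sgN // [w |: (v |: g)]setUCA; ring.
- by rewrite /T eqxx !andbF.
rewrite /kD big_mkcond; apply: eq_bigr => v _; rewrite /T.
case: (v \in h) => /=; last by rewrite big1.
rewrite mulr_sumr -big_split mulr_sumr big_mkcond; apply: eq_bigr => w _ /=.
rewrite !inE andbC; case: ifP => // _; ring.
Qed.

(** For [w != v], removing [w] anticommutes with adding [v] by [sgN], and [divX v] commutes with
    ['X_w]; so only the terms that move [v] itself survive. *)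
Lemma kD_sig v F g h : [disjoint g & h] ->
  kD (ksig v F) g h + ksig v (kD F) g h =
    if v \in g then F g h + divX v (F (g :\ v) h)
    else if v \in h then 'X_v * divX v (F g h) else 0.
Proof.
move=> dgh; rewrite /ksig {1}/kD.
case: ifP => vg.
  have vh : v \notin h by rewrite (disjointFr dgh vg).
  rewrite /kD [X in eps v h * divX v X](bigD1 v) ?setU11 //= divXD mulrDr.
  rewrite setD1K // setU1K // divX_eps divXD divXM.
  rewrite eps_add // sgvv mul1r [eps v h * (eps v h * _)]mulrA epsK mul1r.
  rewrite addrCA -[RHS]addr0; congr (_ + _).
  rewrite divX_sum mulr_sumr [X in _ + X](eq_bigl (fun w => w \in h)); last first.
    by move=> w; rewrite !inE; case: eqVneq => [->|_] /=; rewrite ?andbT ?(negPf vh).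
  rewrite -big_split big1 //= => w wh.
  have wv : w != v by apply: contraNneq vh => <-.
  have vw : v != w by rewrite eq_sym.
  rewrite !inE (negPf vw) vg /= divX_eps divXD (divXMC _ vw).
  have -> : (w |: g) :\ v = w |: g :\ v.
    by apply/setP => x; rewrite !inE; case: eqVneq => //= ->; rewrite (negPf vw).
  have -> : (v |: h) :\ w = v |: h :\ w.
    by apply/setP => x; rewrite !inE; case: (eqVneq x v) => //= ->; rewrite vw.
  rewrite eps_del // eps_add // [sg v w]sgN //; ring.
rewrite addr0; case: ifP => vh.
  rewrite (bigD1 v) //= !inE eqxx vg big1 ?addr0 => [|w /andP[wh wv]].
    rewrite setU1K ?vg // setD1K // eps_del // sgvv mul1r.
    by rewrite mulrCA [eps v h * (eps v h * _)]mulrA epsK mul1r.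
  by rewrite !inE eq_sym (negPf wv) vg !(mulr0, addr0).
rewrite big1 // => w wh; rewrite !inE vg orbF.
case: eqVneq => [vw|_]; last by rewrite !(mulr0, addr0).
by rewrite vw wh in vh.
Qed.

Lemma kDs_tau v F g h : [disjoint g & h] ->
  kDs (ktau v F) g h + ktau v (kDs F) g h =
    if v \in h then F g h
    else if v \in g then 'X_v * divX v (F g h) else divX v (F (v |: g) h).
Proof.
move=> dgh; rewrite /ktau {1}/kDs; case: ifP => vh.
  have vg : v \notin g by rewrite (disjointFl dgh vh).
  rewrite /kDs [X in eps v h * divX v X](bigD1 v) ?inE ?eqxx //= divXD mulrDr.
  rewrite setU1K // setD1K // divX_eps divXM.
  rewrite eps_del // sgvv mul1r [eps v h * (eps v h * _)]mulrA epsK mul1r.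
  rewrite addrCA -[RHS]addr0; congr (_ + _).
  rewrite divX_sum mulr_sumr [X in _ + X](eq_bigl (fun w => w \notin h)); last first.
    by move=> w; rewrite !inE; case: eqVneq => [->|_] /=; rewrite ?andbT ?vh.
  rewrite -big_split big1 //= => w wh.
  have wv : w != v by apply: contraNneq wh => ->.
  have vw : v != w by rewrite eq_sym.
  rewrite !inE vh (negPf wv) orbT /= divX_eps.
  have -> : (v |: g) :\ w = v |: g :\ w.
    by apply/setP => x; rewrite !inE; case: (eqVneq x v) => //= ->; rewrite vw.
  have -> : (w |: h) :\ v = w |: h :\ v.
    by apply/setP => x; rewrite !inE; case: (eqVneq x v) => //= ->; rewrite (negPf vw).
  rewrite eps_del // eps_add // [sg v w]sgN //.
  by case: (w \in g); rewrite ?(divXMC _ vw) ?mul1r; ring.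
rewrite addr0 (bigD1 v) ?vh //= big1 ?addr0 => [|w /andP[wh wv]].
  rewrite setU11 eps_add ?vh // sgvv mul1r setU1K ?vh // mulrCA.
  case: ifP => vg; last first.
    rewrite mul1r mulrA epsK mul1r; congr (divX v (F (v |: _) h)).
    by apply/setP => x; rewrite !inE; case: eqVneq => // ->.
  by rewrite setD1K // [eps v h * (eps v h * _)]mulrA epsK mul1r.
by rewrite !inE eq_sym (negPf wv) vh !mulr0.
Qed.

Lemma sum_setU1 v (R : nmodType) (Phi : {set 'I_n} -> R) :
  \sum_(A : {set 'I_n} | v \in A) Phi A = \sum_(A : {set 'I_n} | v \notin A) Phi (v |: A).
Proof.
rewrite (reindex_onto (fun A => v |: A) (fun A => A :\ v)) /=; last exact: setD1K.
apply: eq_bigl => A; rewrite setU11 /=; apply/eqP/idP => [<-|/setU1K//].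
by rewrite !inE eqxx.
Qed.

(** The sums run over all pairs of sets. On the left, terms with [v] in [g] and [F] taken at
    [(g, v |: h)] have no counterpart on the right; the vanishing of [F] off disjoint pairs removes
    them. *)
Lemma kD_adjoint F F' :
  (forall g h, ~~ [disjoint g & h] -> F g h = 0) ->
  \sum_g \sum_h F g h * kD F' g h = \sum_g \sum_h kDs F g h * F' g h.
Proof.
move=> F0; rewrite /kD /kDs exchange_big [RHS]exchange_big /=.
transitivity (\sum_(v : V) \sum_(h : {set V} | v \notin h) \sum_(g : {set V})
    eps v h * (F g (v |: h) * ('X_v * F' (v |: g) h + F' g h))).
  rewrite [RHS](exchange_big_dep predT) //=.
  have -> : \sum_(j : {set V}) \sum_(i : {set V}) F i j *
      (\sum_(v in j) eps v j * ('X_v * F' (v |: i) (j :\ v) +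
      F' i (j :\ v))) = \sum_(v : V) \sum_(j : {set V} | v \in j) \sum_(i : {set V})
      eps v j * (F i j * ('X_v * F' (v |: i) (j :\ v) + F' i (j :\ v))).
    rewrite [RHS](exchange_big_dep predT) //=; apply: eq_bigr => j _.
    rewrite [RHS]exchange_big; apply: eq_bigr => i _; rewrite mulr_sumr.
    by apply: eq_bigr => v _; rewrite mulrCA.
  rewrite [RHS](exchange_big_dep predT) //=; apply: eq_bigr => v _.
  rewrite sum_setU1; apply: eq_bigr => h vh; apply: eq_bigr => g _.
  by rewrite eps_add // sgvv mul1r setU1K.
rewrite (exchange_big_dep predT) //=; apply: eq_bigr => h _.
rewrite [RHS](eq_bigr (fun g => \sum_(v | v \notin h) eps v h *
   ((if v \in g then 'X_v else 1) * F (g :\ v) (v |: h) * F' g h))); last first.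
  by move=> g _; rewrite mulr_suml; apply: eq_bigr => v _; rewrite !mulrA.
rewrite [RHS]exchange_big; apply: eq_bigr => v vh /=.
rewrite -!mulr_sumr; congr (_ * _).
have dis g : v \in g -> F g (v |: h) = 0.
  move=> vg; apply: F0; apply/negP => /pred0P /(_ v) /=.
  by rewrite vg setU11.
rewrite (bigID (fun g => v \in g)) /= big1 ?add0r => [|g /dis ->]; last by rewrite mul0r.
rewrite [RHS](bigID (fun g => v \in g)) /= sum_setU1 -big_split /=.
apply: eq_bigr => g vg; rewrite setU11 (negPf vg) setU1K // mul1r mulrDr.
congr (_ + _); first by ring.
congr (F _ _ * _); apply/setP => x; rewrite !inE.
by case: eqVneq => // ->; rewrite (negPf vg).
Qed.

End PairComplex.

Lemma free_gen_basis n (k : fieldType) (I : finType) (deg : I -> {set 'I_n}) :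
  @sqfree_basis n k (free_gmod k deg) I deg (@free_gen n k I).
Proof.
split=> [i j|u].
  rewrite !ffunE => m; have [<-|_] := eqVneq; last by rewrite msupp0.
  by rewrite msupp1 inE => /eqP->; rewrite add0m.
exists u; split=> [|c ->]; first exact: free_genE.
apply/ffunP => j; rewrite sum_ffunE (bigD1 j) //= big1 => [|i /negPf ij].
  by rewrite !ffunE eqxx /= addr0 [LHS]mulr1.
by rewrite !ffunE ij [LHS]mulr0.
Qed.

(** * The pair complex of a simplicial complex and its exactness *)

Section PairComplexOf.
Variables (n : nat) (k : fieldType) (G : scomplex n).
Local Notation S := {mpoly k[n]}.
Implicit Types (v w : 'I_n) (g h : {set 'I_n}) (F : {set 'I_n} -> {set 'I_n} -> S)
  (i j : int).

Definition pvalid (x : {set 'I_n} * {set 'I_n}) : bool :=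
  [disjoint x.1 & x.2] && (x.1 :|: x.2 \in faces G).

Lemma pvalid_disj g h : pvalid (g, h) -> [disjoint g & h].
Proof. by case/andP. Qed.

Lemma pvalid_up v g h : v \in h -> pvalid (g, h) -> pvalid (v |: g, h :\ v).
Proof.
move=> vh /andP[/= /pred0P d gh]; apply/andP; split => /=.
  apply/pred0P => x /=; have := d x; rewrite /= !inE.
  by case: eqVneq => //=.
by rewrite -setUA setUCA setD1K.
Qed.

Lemma pvalid_down v g h : v \in g -> pvalid (g, h) -> pvalid (g :\ v, v |: h).
Proof.
move=> vg /andP[/= /pred0P d gh]; apply/andP; split => /=.
  apply/pred0P => x /=; have := d x; rewrite /= !inE.
  by case: eqVneq => //=.
by rewrite setUCA setUA setD1K.
Qed.

Lemma pvalid_del v g h : pvalid (g, h) -> pvalid (g, h :\ v).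
Proof.
move=> /andP[/= d gh]; apply/andP; split => /=.
  by apply: disjointWr d; apply: subD1set.
by apply: facesP gh _; apply: setUS; apply: subD1set.
Qed.

Definition kidx i : Type := {x : {set 'I_n} * {set 'I_n} | pvalid x && (#|x.2|%:Z == i)}.
HB.instance Definition _ i := Finite.on (kidx i).

Definition kdeg i (x : kidx i) : {set 'I_n} := (val x).1.
Definition kterm i : gmod n k := free_gmod k (@kdeg i).

(** Extension by zero to all pairs, so that sums can be reindexed over plain sets, free of the
    subtypes that depend on the degree. *)
Definition kext i (z : kterm i) g h : S :=
  if insub (g, h) is Some x then z x else 0.
Definition kres i F : kterm i := [ffun x : kidx i => F (val x).1 (val x).2].

Lemma kext_val i (z : kterm i) (x : kidx i) : kext z (val x).1 (val x).2 = z x.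
Proof. by rewrite /kext -surjective_pairing valK. Qed.

Lemma kext_out i (z : kterm i) g h :
  ~~ (pvalid (g, h) && (#|h|%:Z == i)) -> kext z g h = 0.
Proof. by move=> H; rewrite /kext insubN. Qed.

Lemma kext_res i F g h :
  kext (kres i F) g h = if pvalid (g, h) && (#|h|%:Z == i) then F g h else 0.
Proof. by rewrite /kext; case: insubP => [x -> e|/negPf-> //]; rewrite ffunE e. Qed.

Lemma kext_inj i (z z' : kterm i) :
  (forall g h, pvalid (g, h) -> #|h|%:Z = i -> kext z g h = kext z' g h) -> z = z'.
Proof.
move=> e; apply/ffunP => x; rewrite -!kext_val; have /andP[v /eqP c] := valP x.
by apply: e => //; rewrite -surjective_pairing.
Qed.

Lemma kext_lin i a (z z' : kterm i) g h :
  kext (a *: z + z') g h = a * kext z g h + kext z' g h.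
Proof. by rewrite /kext; case: insub => [x|]; rewrite ?mulr0 ?addr0 // !ffunE. Qed.

Lemma kext0 i g h : kext (0 : kterm i) g h = 0.
Proof. by rewrite /kext; case: insub => // x; rewrite ffunE. Qed.

Lemma kextB i (z z' : kterm i) g h : kext (z - z') g h = kext z g h - kext z' g h.
Proof. by rewrite /kext; case: insub => [x|]; rewrite ?subr0 // !ffunE. Qed.

Lemma kext_grade i b (z : kterm i) :
  grade b z <-> forall g h, @twist_deg n k g b (kext z g h).
Proof.
split=> [hz g h|hz x]; last by rewrite -kext_val; apply: hz.
rewrite /kext; case: insubP => [x _ e|_]; last exact: (grade0 (twist k g)).
by have := hz x; rewrite /kdeg e.
Qed.

Lemma eq_kD F F' g h :
  (forall v, v \in h -> F (v |: g) (h :\ v) = F' (v |: g) (h :\ v)) ->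
  (forall v, v \in h -> F g (h :\ v) = F' g (h :\ v)) -> kD F g h = kD F' g h.
Proof. by move=> e1 e2; apply: eq_bigr => v vh; rewrite e1 ?e2. Qed.

Lemma kD0 F g h :
  (forall v, v \in h -> F (v |: g) (h :\ v) = 0) ->
  (forall v, v \in h -> F g (h :\ v) = 0) -> kD F g h = 0.
Proof. by move=> e1 e2; apply: big1 => v vh; rewrite e1 ?e2 // mulr0 addr0 mulr0. Qed.

Definition kdiff_fun i j (z : kterm i) : kterm j := kres j (kD (kext z)).

Lemma kdiff_linear i j : linear (@kdiff_fun i j).
Proof.
move=> a z z'; apply/ffunP => x; rewrite !ffunE /kD.
rewrite scaler_sumr -big_split; apply: eq_bigr => v _.
have E (e y A A' B B' : S) : e * (y * (a * A + A') + (a * B + B')) =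
  a * (e * (y * A + B)) + e * (y * A' + B') by ring.
by rewrite !kext_lin; apply: E.
Qed.

HB.instance Definition _ i j :=
  GRing.isLinear.Build S (kterm i) (kterm j) _ (@kdiff_fun i j) (@kdiff_linear i j).

Definition kdiff i j : {linear kterm i -> kterm j} := @kdiff_fun i j.

Lemma card_del v h : v \in h -> #|h|%:Z = #|h :\ v|%:Z + 1.
Proof. by move=> vh; rewrite (cardsD1 v h) vh PoszD addrC. Qed.

Lemma kext_diff i j (z : kterm i) g h : j = i + 1 -> pvalid (g, h) ->
  kext (kdiff i j z) g h = kD (kext z) g h.
Proof.
move=> -> gh; rewrite kext_res gh /=; case: eqP => // hi.
rewrite kD0 // => v vh; apply: kext_out; apply/negP => /andP[_ /eqP e];
  by apply: hi; rewrite (card_del vh) e.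
Qed.

Lemma kdiff_shape i j : j != i + 1 -> forall z, kdiff i j z = 0.
Proof.
move=> ij z; apply: kext_inj => g h gh hj; rewrite kext0 kext_res gh hj eqxx /=.
rewrite kD0 // => v vh; apply: kext_out; apply/negP => /andP[_ /eqP e];
  by move/negP: ij; apply; rewrite -hj (card_del vh) e.
Qed.

Lemma kdiff_comp i j l z : kdiff j l (kdiff i j z) = 0.
Proof.
have [->|ij] := eqVneq j (i + 1); last by rewrite (kdiff_shape ij) linear0.
apply: kext_inj => g h gh hl; rewrite kext0 kext_res gh hl eqxx /=.
rewrite -[RHS](kDD (kext z) g h); apply: eq_kD => v vh; rewrite kext_diff //.
  exact: pvalid_up.
exact: pvalid_del.
Qed.

Lemma kdiff_grade i j b z : grade b z -> grade b (kdiff i j z).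
Proof.
move=> /kext_grade hz; apply/kext_grade => g h; rewrite kext_res.
case: ifP => [/andP[gh _]|_]; last exact: (grade0 (twist k g)).
apply: (grade_sum (M := twist k g)) => v vh.
have sgn a (p : S) : @twist_deg n k g b p -> @twist_deg n k g b ((-1) ^+ a * p).
  rewrite -signr_odd; case: (odd a); rewrite ?expr1 ?expr0 ?mulN1r ?mul1r //.
  exact: (@gradeN n k (twist k g)).
apply: sgn; apply: (@gradeD n k (twist k g)); last exact: hz.
move=> m; rewrite [in X in X -> _]mulrC (perm_mem (msuppMX _ _)) => /mapP[m' hm ->].
rewrite -(hz _ _ _ hm); apply/mnmP => x; rewrite !mnmE !inE.
have vg : v \notin g by rewrite (disjointFl (pvalid_disj gh) vh).
rewrite [v == x]eq_sym; case: (eqVneq x v) => [->|_] /=;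
  rewrite ?(negPf vg) ?add0n ?add1n ?addn0 ?addn1 //.
Qed.

Definition kcx : gcomplex n k := GComplex kdiff_grade kdiff_shape kdiff_comp.

Lemma kcx_free i : free_sqfree (kcx i).
Proof. exact: free_gmod_free. Qed.

Lemma kterm_out i (z : kterm i) : ~~ (0 <= i <= n%:Z) -> z = 0.
Proof.
move=> hi; apply: kext_inj => g h _ e; exfalso; move/negP: hi; apply.
by rewrite -e; move: (max_card h); rewrite card_ord; move: #|h| => c; lia.
Qed.

Lemma kcx_bounded : exists N : nat, forall i : int, (N < `|i|)%N ->
  forall z : kcx i, z = 0.
Proof. by exists n => i hi z; apply: kterm_out; lia. Qed.

Definition kcomplex : fsq_complex n k := FsqComplex kcx_free kcx_bounded.

(* Along each variable [v] the homotopy [ksig v] replaces [z] by a cohomologous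
   cocycle for which the divisibility hypothesis does not involve [v] any more. *)
Lemma kcomplex_exact (s : seq 'I_n) i (z : kcomplex i) : cocycle z ->
  (forall g h, (forall v, v \in s -> v \notin g) ->
     forall m, m \in msupp (kext z g h) ->
       exists v, [/\ v \in s, v \in h & m v != 0%N]) ->
  exists2 y : kcomplex (i - 1), z = cdiff kcomplex (i - 1) i y &
    forall h, kext y set0 h = 0.
Proof.
have ei : i = (i - 1) + 1 by rewrite subrK.
elim: s z => [|v s IH] z hz hs.
  exists 0 => [|h]; last exact: kext0.
  rewrite linear0; apply: kext_inj => g h _ _; rewrite kext0.
  apply/mpolyP => m; rewrite mcoeff0; apply/eqP; rewrite mcoeff_eq0.
  by apply/negP => hm; have [//|x []] := hs g h _ m hm.
pose F := kext z; pose y := kres (i - 1) (ksig v F).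
have ye g h : pvalid (g, h) -> kext y g h = ksig v F g h.
  move=> gh; rewrite kext_res gh /=; case: eqP => // hi.
  rewrite /ksig; case: ifP => // vg; rewrite /F kext_out ?divX0 ?mulr0 //.
  apply/negP => /andP[_ /eqP e]; apply: hi; rewrite -e cardsU1.
  by rewrite (disjointFr (pvalid_disj gh) vg) /= PoszD addrAC subrr add0r.
pose z1 := z - cdiff kcomplex (i - 1) i y.
have z1e g h : pvalid (g, h) -> kext z1 g h =
    if v \in g then - divX v (F (g :\ v) h)
    else if v \in h then F g h - 'X_v * divX v (F g h) else F g h.
  move=> gh; rewrite kextB (kext_diff _ ei) //.
  have -> : kD (kext y) g h = kD (ksig v F) g h.
    by apply: eq_kD => w wh; rewrite ye //; [exact: pvalid_up|exact: pvalid_del].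
  have := kD_sig v F (pvalid_disj gh).
  have -> : ksig v (kD F) g h = 0.
    rewrite /ksig; case: ifP => // vg; rewrite -(kext_diff z erefl); last exact: pvalid_down.
    by have /= -> := hz (i + 1); rewrite kext0 divX0 mulr0.
  rewrite addr0 => ->; rewrite -/F.
  by case: ifP => _; [rewrite opprD addNKr|case: ifP; rewrite ?subr0].
have [|g h hg m hm|y1 hy1 y10] := IH z1.
- by apply: cocycleB => //; apply: coboundary_cocycle; exists (i - 1), y.
- have gh : pvalid (g, h).
    apply: contraT => gh; move: hm; rewrite kext_out ?msupp0 // (negPf gh) //.
  (* The variable supplied by the hypothesis for [v :: s] must be shown to differ from [v]. In the
     three cases this holds because [v] lies in [g], which is disjoint from [h]; because the
     remainder modulo ['X_v] contains no [v]; or because [v] is not in [h]. *)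
  move: hm; rewrite z1e //; case: (boolP (v \in g)) => vg.
    rewrite (perm_mem (msuppN _)) mcoeff_msupp mcoeff_divX -mcoeff_msupp => hm.
    have [|w [ws wh]] := hs _ _ _ _ hm.
      move=> w; rewrite !inE => /orP[/eqP->|/hg/negPf->]; first by rewrite eqxx.
      by rewrite andbF.
    have vw : (v == w) = false.
      by apply/eqP => e; move: wh; rewrite -e (disjointFr (pvalid_disj gh) vg).
    rewrite !mnmE vw => mw; exists w; split => //.
    by move: ws; rewrite inE eq_sym vw.
  have hg' w : w \in v :: s -> w \notin g by rewrite inE => /orP[/eqP->|/hg].
  case: ifP => vh.
    rewrite mcoeff_msupp mcoeff_resX; case: (eqVneq (m v) 0%N) => mv; last by rewrite eqxx.
    rewrite -mcoeff_msupp => /(hs _ _ hg')[w [ws wh mw]]; exists w; split => //.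
    by move: ws mw; rewrite inE => /orP[/eqP->|//]; rewrite mv.
  move=> /(hs _ _ hg')[w [ws wh mw]]; exists w; split => //.
  by move: ws wh; rewrite inE => /orP[/eqP->|//]; rewrite vh.
exists (y1 + y) => [|h]; first by rewrite linearD /= -hy1 subrK.
rewrite -[y1]scale1r kext_lin mul1r y10 add0r kext_res.
by case: ifP => //; rewrite /ksig inE.
Qed.

End PairComplexOf.

(** * Homomorphisms from the pair complex to $\omega_S$ *)

Section PairComplexDual.
Variables (n : nat) (k : fieldType) (G : scomplex n).
Local Notation S := {mpoly k[n]}.
Local Notation K := (kcomplex k G).
Local Notation W := (omegaS n k).
Local Notation gen x := (@free_gen n k _ x).
Implicit Types (v w : 'I_n) (g h : {set 'I_n}) (F : {set 'I_n} -> {set 'I_n} -> S)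
  (i j : int).

Definition kval i (f : homS (K i) W) g h : S :=
  if insub (g, h) is Some x then homS_fun f (gen x) else 0.

Lemma kval_out i (f : homS (K i) W) g h :
  ~~ (pvalid G (g, h) && (#|h|%:Z == i)) -> kval f g h = 0.
Proof. by move=> H; rewrite /kval insubN. Qed.

Lemma kval_val i (f : homS (K i) W) (x : kidx G i) :
  kval f (val x).1 (val x).2 = homS_fun f (gen x).
Proof. by rewrite /kval -surjective_pairing valK. Qed.

Lemma kvalB i (f f' : homS (K i) W) g h : kval (f - f') g h = kval f g h - kval f' g h.
Proof. by rewrite /kval; case: insub => [x|]; rewrite ?subr0. Qed.

Lemma kval0 i g h : kval (0 : homS (K i) W) g h = 0.
Proof. by rewrite -[X in kval X](subrr 0) kvalB subrr. Qed.

Lemma kvalE i (f : homS (K i) W) (z : K i) :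
  homS_fun f z = \sum_g \sum_h kval f g h * kext z g h.
Proof.
rewrite pair_big /= (bigID (fun x => pvalid G x && (#|x.2|%:Z == i))) /=.
rewrite [X in _ + X]big1 ?addr0 => [|[g h] /= H]; last by rewrite kext_out ?mulr0.
rewrite (big_sub (fun x => pvalid G x && (#|x.2|%:Z == i))
  (fun x => kval f x.1 x.2 * kext z x.1 x.2)).
rewrite {1}[z]free_genE linear_sum; apply: eq_bigr => x _.
by rewrite linearZ kext_val kval_val; apply: mulrC.
Qed.

Lemma kval_inj i (f f' : homS (K i) W) :
  (forall g h, pvalid G (g, h) -> #|h|%:Z = i -> kval f g h = kval f' g h) -> f = f'.
Proof.
move=> e; apply/homSP => z; rewrite !kvalE; apply: eq_bigr => g _.
apply: eq_bigr => h _; case: (boolP (pvalid G (g, h) && (#|h|%:Z == i))) => gh.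
  by have /andP[v /eqP c] := gh; rewrite e.
by rewrite kext_out ?mulr0.
Qed.

Lemma kfun_exists i F : exists f : homS (K i) W,
  forall g h, kval f g h = if pvalid G (g, h) && (#|h|%:Z == i) then F g h else 0.
Proof.
have [f hf] := basis_lift (@free_gen_basis n k _ (@kdeg n G i))
  (fun x : kidx G i => F (val x).1 (val x).2 : W).
exists (homS_of f) => g h; rewrite /kval.
by case: insubP => [x -> e|/negPf-> //]; rewrite /= hf e.
Qed.

(** The adjunction applied to a basis vector, whose coefficients leave only the term at $(g,h)$. *)
Lemma kval_diff i j (f : homS (K j) W) g h : j = i + 1 ->
  pvalid G (g, h) -> #|h|%:Z = i ->
  kval (precomp (cdiff K i j) f) g h = kDs (kval f) g h.
Proof.
move=> ij gh hi; rewrite {1}/kval insubT /= ?gh ?hi ?eqxx // => H.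
set x : kidx G i := Sub _ _; rewrite [LHS](_ : _ = homS_fun f (kdiff k G i j (gen x))) // kvalE.
have -> : \sum_g \sum_h kval f g h * kext (kdiff k G i j (gen x)) g h =
    \sum_g \sum_h kval f g h * kD (kext (gen x : K i)) g h.
  apply: eq_bigr => g' _; apply: eq_bigr => h' _.
  have [gh'|gh'] := boolP (pvalid G (g', h')); first by rewrite kext_diff.
  by rewrite kval_out ?mul0r // (negPf gh').
rewrite kD_adjoint => [|g' h' d]; last first.
  by rewrite kval_out //; apply: contra d => /andP[/pvalid_disj].
rewrite (bigD1 g) //= [X in _ + X]big1 ?addr0 => [|g' /negPf g'g]; last first.
  rewrite big1 // => h' _; rewrite /kext; case: insubP => [y _ e|]; rewrite ?mulr0 //.
  rewrite ffunE; case: eqVneq => [xy|]; rewrite ?mulr0 //.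
  by move: e; rewrite -xy /= => -[e _]; rewrite e eqxx in g'g.
rewrite (bigD1 h) //= [X in _ + X]big1 ?addr0 => [|h' /negPf h'h]; last first.
  rewrite /kext; case: insubP => [y _ e|]; rewrite ?mulr0 //.
  rewrite ffunE; case: eqVneq => [xy|]; rewrite ?mulr0 //.
  by move: e; rewrite -xy /= => -[e]; rewrite e eqxx in h'h.
by rewrite (kext_val (gen x : K i) x) ffunE eqxx mulr1.
Qed.

(* Along each variable [v] the homotopy [ktau v] kills the values of [f] on the
   pairs [(g, h)] with [v \in h] and, for [v \in g], makes them free of [v]. *)
Lemma kcomplex_dual_reduce (s : seq 'I_n) i (f : homS (K i) W) :
  (forall j (z : K j), homS_fun f (cdiff K j i z) = 0) ->
  (forall g h, kval f g h != 0 -> forall v, v \in h -> v \in s) ->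
  (forall g h v, v \in g -> v \notin s -> forall m, m \in msupp (kval f g h) -> m v = 0%N) ->
  exists (f' : homS (K i) W) (e : homS (K (i + 1)) W),
    [/\ f = f' + precomp (cdiff K i (i + 1)) e,
        forall g h, kval f' g h != 0 -> h = set0
      & forall g h v, v \in g -> forall m, m \in msupp (kval f' g h) -> m v = 0%N].
Proof.
elim: s f => [|v s IH] f cf sf nf.
  exists f, 0; split => [|g h fn0|g h v vg m]; first by rewrite linear0 addr0.
    by apply/eqP; rewrite -subset0; apply/subsetP => x /(sf g h fn0).
  exact: nf.
have [e0 he0] := kfun_exists (i + 1) (ktau v (kval f)).
have e0E g h : pvalid G (g, h) -> kval e0 g h = ktau v (kval f) g h.
  move=> gh; rewrite he0 gh /=; case: eqP => // hi.
  rewrite /ktau; case: ifP => // vh; rewrite kval_out ?divX0 ?mulr0 //.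
  by apply/negP => /andP[_ /eqP e]; apply: hi; rewrite (card_del vh) e.
pose f1 := f - precomp (cdiff K i (i + 1)) e0.
have f1E g h : pvalid G (g, h) -> #|h|%:Z = i -> kval f1 g h =
    if v \in h then 0
    else if v \in g then kval f g h - 'X_v * divX v (kval f g h)
    else kval f g h - divX v (kval f (v |: g) h).
  move=> gh hi; rewrite kvalB kval_diff //.
  have -> : kDs (kval e0) g h = kDs (ktau v (kval f)) g h.
    (* Unlike [kD], the operator [kDs] can leave the valid pairs, since inserting [w] may leave the
       complex. There [e0] vanishes, and so does [ktau]: if its argument were a valid pair, moving
       [v] back from the first set to the second would make the original pair valid. *)
    apply: eq_bigr => w wh; have [gh'|gh'] := boolP (pvalid G (g :\ w, w |: h)).
      by rewrite e0E.
    rewrite [kval e0 _ _]kval_out ?(negPf gh') // /ktau.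
    case: (boolP (v \in w |: h)) => // vh.
    rewrite kval_out; first by rewrite divX0 !mulr0.
    apply: contra gh' => /andP[gh' _].
    have := pvalid_down (setU11 v (g :\ w)) gh'; rewrite setD1K //.
    case: (boolP (v \in g :\ w)) => vg; last by rewrite setU1K.
    exfalso; move: vg vh; rewrite !inE => /andP[/negPf-> vg] /=.
    by rewrite (disjointFr (pvalid_disj gh) vg).
  have := kDs_tau v (kval f) (pvalid_disj gh).
  have -> : ktau v (kDs (kval f)) g h = 0.
    rewrite /ktau; case: ifP => // vh.
    have hi' : #|h :\ v|%:Z = i - 1 by rewrite -hi (card_del vh) addrK.
    rewrite -(@kval_diff (i - 1) i) ?subrK //; last exact: pvalid_up.
    suff -> : precomp (cdiff K (i - 1) i) f = 0.
      by rewrite kval0 divX0 mulr0.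
    by apply/homSP => z; apply: cf.
  rewrite addr0 => ->; case: ifP => _; first by rewrite subrr.
  by case: ifP.
have kz g h : kval f1 g h != 0 -> pvalid G (g, h) /\ #|h|%:Z = i.
  move=> H; have : pvalid G (g, h) && (#|h|%:Z == i).
    by apply: contraNT H => /kval_out->.
  by case/andP => ? /eqP.
have [|g h H w wh|g h w wg ws m hm|f' [e [ef sf' nf']]] := IH f1.
- move=> j z.
  have -> : homS_fun f1 (cdiff K j i z) =
    homS_fun f (cdiff K j i z) - homS_fun e0 (cdiff K i (i + 1) (cdiff K j i z)) by [].
  by rewrite cf (cdiff_comp (g := kcx k G)) linear0 subr0.
- have [gh hi] := kz _ _ H; move: H; rewrite f1E //.
  case: (boolP (v \in h)) => vh; first by rewrite eqxx.
  have vw : w == v = false by apply: contraNF vh => /eqP<-.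
  have [f0|/sf H] := eqVneq (kval f g h) 0; last first.
    by move=> _; have := H w wh; rewrite inE vw.
  rewrite f0 divX0 mulr0 subr0; case: ifP => _; first by rewrite eqxx.
  have [->|/sf H _] := eqVneq (kval f (v |: g) h) 0; first by rewrite divX0 subr0 eqxx.
  by have := H w wh; rewrite inE vw.
- have H : kval f1 g h != 0 by apply: contraTneq hm => ->; rewrite msupp0.
  have [gh hi] := kz _ _ H; move: hm; rewrite f1E //.
  case: ifP => vh; first by rewrite msupp0.
  have [wv|wv] := eqVneq w v.
    subst w; rewrite wg mcoeff_msupp mcoeff_resX.
    by case: (eqVneq (m v) 0%N) => //; rewrite eqxx.
  have ws' : w \notin v :: s by rewrite inE negb_or wv.
  case: ifP => vg.
    rewrite mcoeff_msupp mcoeff_resX; case: (eqVneq (m v) 0%N) => mv; last by rewrite eqxx.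
    rewrite -mcoeff_msupp; exact: nf wg ws' m.
  move=> /msuppB_le; rewrite mem_cat => /orP[|]; first exact: nf wg ws' m.
  rewrite mcoeff_msupp mcoeff_divX -mcoeff_msupp => hm.
  have := nf (v |: g) h w _ ws' _ hm; rewrite !mnmE eq_sym (negPf wv) add0n; apply.
  by rewrite !inE wg orbT.
exists f', (e + e0); split => //; rewrite linearD addrA -ef /f1 subrK //.
Qed.

(** At $(g,\{v\})$ the Koszul term $x_v\cdot x^{V\setminus(g\cup v)}$ meets $x^{V\setminus g}$ with
    the opposite sign, so the differential vanishes; each summand has multidegree $V$. *)
Definition kcycle : K 0 := kres G 0 (fun g h => (-1) ^+ #|g| * 'X_[sq (~: g)]).

Lemma pvalid_set0 g : pvalid G (g, set0) = (g \in faces G).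
Proof. by rewrite /pvalid /= -setI_eq0 setI0 eqxx setU0. Qed.

Lemma kext_kcycle g : kext kcycle g set0 =
  if g \in faces G then (-1) ^+ #|g| * 'X_[sq (~: g)] else 0.
Proof. by rewrite kext_res cards0 eqxx andbT pvalid_set0. Qed.

Lemma kcycle_grade : grade (sq setT) kcycle.
Proof.
apply/kext_grade => g h; rewrite kext_res; case: ifP => _; last exact: (grade0 (twist k g)).
rewrite -[_ * 'X_[_]]scale1r.
have -> : sq [set: 'I_n] = (sq (~: g) + sq g)%MM.
  by apply/mnmP => x; rewrite !mnmE !inE; case: (x \in g).
have -> : 1 *: ((-1) ^+ #|g| * 'X_[sq (~: g)]) = ((-1) ^+ #|g| : k) *: 'X_[sq (~: g)] :> S.
  by rewrite scale1r -mul_mpolyC rmorphXn rmorphN1.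
exact: twist_deg_monom.
Qed.

Lemma kcycle_cocycle : cocycle kcycle.
Proof.
apply: (@cocycleP _ _ _ _ 1) => //; apply: kext_inj => g h gh h1.
rewrite kext0 kext_diff // /kD big1 // => v vh.
have hv : h :\ v = set0.
  apply/eqP; rewrite -cards_eq0; apply/eqP.
  by have := card_del vh; rewrite h1; move: #|h :\ v| => c; lia.
have vg : v \notin g by rewrite (disjointFl (pvalid_disj gh) vh).
have := pvalid_up vh gh; have := pvalid_del v gh; rewrite hv !pvalid_set0 => gG vgG.
rewrite !kext_kcycle gG vgG cardsU1 vg add1n exprS.
have -> : sq (~: g) = (U_(v) + sq (~: (v |: g)))%MM.
  apply/mnmP => x; rewrite !mnmE !inE eq_sym.
  by case: (eqVneq x v) => [->|_] //=; rewrite (negPf vg).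
by rewrite mpolyXD; ring.
Qed.

Lemma kval_kcycle (f : homS (K 0) W) : homS_fun f kcycle =
  \sum_(g in faces G) (-1) ^+ #|g| * 'X_[sq (~: g)] * kval f g set0 :> S.
Proof.
rewrite kvalE [RHS]big_mkcond; apply: eq_bigr => g _.
rewrite (bigD1 set0) //= [X in _ + X]big1 ?addr0 => [|h h0]; last first.
  rewrite kval_out ?mul0r //; apply: contra h0 => /andP[_].
  by rewrite eqz_nat cards_eq0.
by rewrite kext_kcycle; case: ifP; rewrite ?mulr0 // mulrC.
Qed.

Lemma kcomplex_dual_exact i (f : homS (K i) W) : i != 0 ->
  (forall j (z : K j), homS_fun f (cdiff K j i z) = 0) ->
  exists e : homS (K (i + 1)) W, f = precomp (cdiff K i (i + 1)) e.
Proof.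
move=> i0 cf; have [f' [e [-> sf _]]] := @kcomplex_dual_reduce (enum 'I_n) i f cf
  (fun _ _ _ v _ => mem_enum predT v) (fun _ _ v _ vs => ltac:(by rewrite mem_enum in vs)).
exists e; rewrite [f'](_ : _ = 0) ?add0r //; apply: kval_inj => g h gh hi.
rewrite kval0; apply: contraNeq i0 => /sf h0.
by rewrite -hi h0 cards0.
Qed.

Lemma kcomplex_dual_exact0 (f : homS (K 0) W) : homS_fun f kcycle = 0 ->
  exists e : homS (K 1) W, f = precomp (cdiff K 0 1) e.
Proof.
move=> f0; have [|f' [e [ef _ nf]]] := @kcomplex_dual_reduce (enum 'I_n) 0 f _
  (fun _ _ _ v _ => mem_enum predT v) (fun _ _ v _ vs => ltac:(by rewrite mem_enum in vs)).
  move=> j z; have [j0|j0] := eqVneq j (-1); last first.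
    by rewrite cdiff_shape ?linear0 //; move: j0; lia.
  by rewrite (kterm_out z) ?linear0 // j0.
exists e; rewrite ef [f'](_ : _ = 0) ?add0r //.
have {f0} : homS_fun f' kcycle = 0 :> S.
  have <- : homS_fun f kcycle = 0 :> S by [].
  rewrite ef [RHS](_ : _ = homS_fun f' kcycle + homS_fun e (cdiff K 0 (0 + 1) kcycle)) //.
  by rewrite kcycle_cocycle linear0 addr0.
rewrite kval_kcycle => f0; apply: kval_inj => g h gh /eqP.
rewrite eqz_nat cards_eq0 => /eqP h0; subst h; rewrite kval0.
rewrite pvalid_set0 in gh.
apply/mpolyP => m; rewrite mcoeff0; apply/eqP; rewrite mcoeff_eq0.
apply/negP => hm; move/(congr1 (mcoeff (m + sq (~: g))%MM)): f0.
have cE p (q : S) l : ((-1) ^+ p * 'X_[l] * q : S) = (-1) ^+ p *: (q * 'X_[l]).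
  by rewrite -mulrA [_ * q]mulrC -mul_mpolyC rmorphXn rmorphN1.
(* No cancellation between different [g]: the value at [g] contains no variable of [g], so every
   monomial of its multiple by $x^{V\setminus g}$ has support exactly $V\setminus g$ and determines
   [g]. *)
rewrite mcoeff0 raddf_sum /= (bigD1 g) //= big1 ?addr0 => [|g' /andP[_ g'g]].
  rewrite cE mcoeffZ addmC mcoeffMX => /eqP; rewrite mulf_eq0 signr_eq0 /=.
  by rewrite mcoeff_eq0 hm.
rewrite cE mcoeffZ; apply/eqP; rewrite mulf_eq0; apply/orP; right.
rewrite mcoeff_eq0 (perm_mem (msuppMX _ _)); apply: contra g'g => /mapP[m' hm' e'].
apply/eqP/setP => x; move/mnmP/(_ x): e'; rewrite !mnmE !inE.
have := nf g set0 x; have := nf g' set0 x.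
case: (x \in g'); case: (x \in g) => //=.
- by move=> /(_ isT _ hm') -> _; rewrite addn1.
- by move=> _ /(_ isT _ hm) ->.
Qed.

Lemma kcycle_image (p : S^o) : p \in @in_SR_ideal n k (alexander_complex G) <->
  exists f : homS (K 0) W, p = homS_fun f kcycle.
Proof.
split=> [/in_SR_idealP[c ->]|[f ->]].
  have [f hf] := kfun_exists 0 (fun g _ => (-1) ^+ #|g| * c (~: g)).
  exists f; rewrite kval_kcycle (reindex_inj (@setC_inj _)) /=.
  apply: eq_big => g; first by rewrite !inE negbK setCK.
  rewrite !inE negbK setCK => gG; rewrite hf pvalid_set0 gG cards0 eqxx /=.
  have E (e x y : S) : e * x * (e * y) = e * e * (y * x) by ring.
  by rewrite E -expr2 sqrr_sign mul1r.
rewrite kval_kcycle; apply/in_SR_idealP.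
exists (fun R => (-1) ^+ #|~: R| * kval f (~: R) set0).
rewrite (reindex_inj (@setC_inj _)) /=; apply: eq_big => R; first by rewrite !inE negbK.
by rewrite setCK => _; rewrite mulrAC.
Qed.

End PairComplexDual.

(** * The complex of pairs resolves the sums of face quotients *)

Section PairComplexAugmentation.
Variables (n : nat) (k : fieldType) (G : scomplex n) (N : gcomplex n k).
Local Notation S := {mpoly k[n]}.
Local Notation K := (kcomplex k G).
Implicit Types (v w : 'I_n) (g h : {set 'I_n}) (i j : int).

(* The terms of [N] are the direct sums of the S/(x_v : v \in h), for the faces
   [h] with [i] elements, and [nu i h] is the class of 1 in the summand of [h]. *)
Record face_quotients (nu : forall i, {set 'I_n} -> N i) : Prop := FaceQuotients {
  fq_grade : forall i h, grade 0%MM (nu i h);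
  fq_out : forall i h, ~~ ((h \in faces G) && (#|h|%:Z == i)) -> nu i h = 0;
  fq_ann : forall i h v, v \in h -> 'X_v *: nu i h = 0;
  fq_diff : forall i h,
    cdiff N i (i + 1) (nu i h) = \sum_(v | v \notin h) eps k v h *: nu (i + 1) (v |: h);
  fq_span : forall i (y : N i), exists c : {set 'I_n} -> S, y = \sum_h c h *: nu i h;
  fq_indep : forall i (c : {set 'I_n} -> S), \sum_h c h *: nu i h = 0 ->
    forall h, h \in faces G -> #|h|%:Z = i ->
    forall m, m \in msupp (c h) -> exists2 v, v \in h & m v != 0%N
}.

Variable nu : forall i, {set 'I_n} -> N i.
Hypothesis nuP : face_quotients nu.

Definition kaug_fun i (z : K i) : N i := \sum_h kext z set0 h *: nu i h.

Lemma kaug_linear i : linear (@kaug_fun i).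
Proof.
move=> a z z'; rewrite /kaug_fun scaler_sumr -big_split; apply: eq_bigr => h _ /=.
by rewrite kext_lin scalerDl scalerA.
Qed.

HB.instance Definition _ i :=
  GRing.isLinear.Build S (K i) (N i) _ (@kaug_fun i) (@kaug_linear i).

Definition kaug i : {linear K i -> N i} := @kaug_fun i.

Lemma kaug_grade i b (z : K i) : grade b z -> grade b (kaug i z).
Proof.
move=> /kext_grade hz; apply: grade_sum => h _.
rewrite [kext z set0 h]mpolyE scaler_suml big_seq; apply: grade_sum => m hm.
have -> : b = (m + 0)%MM.
  rewrite -(hz set0 h m hm); congr (_ + _)%MM; apply/mnmP => x.
  by rewrite !mnmE inE.
exact/grade_monom/fq_grade.
Qed.

Lemma pvalid_0 h : pvalid G (set0, h) = (h \in faces G).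
Proof. by rewrite /pvalid /= disjoint_sym -setI_eq0 setI0 eqxx set0U. Qed.

Lemma kaug_chain_map : chain_map kaug.
Proof.
move=> i j z; have [->|ij] := eqVneq j (i + 1); last by rewrite !cdiff_shape ?linear0.
transitivity (\sum_(v : 'I_n) \sum_(h : {set 'I_n} | v \notin h)
  (eps k v h * kext z set0 h) *: nu (i + 1) (v |: h)).
  rewrite [LHS](_ : _ = \sum_(h : {set 'I_n}) \sum_(v in h)
     (eps k v (h :\ v) * kext z set0 (h :\ v)) *: nu (i + 1) h).
    rewrite (exchange_big_dep predT) //=; apply: eq_bigr => v _.
    rewrite sum_setU1; apply: eq_bigr => h vh; by rewrite setU1K.
  apply: eq_bigr => h _; have [hG|hG] := boolP (h \in faces G); last first.
    by rewrite (fq_out nuP) ?(negPf hG) // scaler0 big1 // => v _; rewrite scaler0.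
  rewrite kext_diff ?pvalid_0 // scaler_suml; apply: eq_bigr => v vh.
  have E (e x a b : S) : e * (x * a + b) = e * a * x + e * b by ring.
  rewrite E scalerDl -[(_ * 'X_v) *: _]scalerA (fq_ann nuP) // scaler0 add0r.
  by rewrite eps_del // sgvv mul1r.
rewrite (exchange_big_dep predT) //= linear_sum; apply: eq_bigr => h _.
rewrite linearZ /= (fq_diff nuP) scaler_sumr; apply: eq_bigr => v _.
by rewrite scalerA mulrC.
Qed.

(** The kernel of the surjection [kaug] is acyclic. By [fq_indep], [kaug i z = 0] is the
    divisibility hypothesis of [kcomplex_exact] for the list of all vertices, where only [g = set0]
    occurs. *)
Lemma kaug_exact i j (z : K i) : i = j + 1 -> cocycle z -> kaug i z = 0 ->
  exists2 y : K j, z = cdiff K j i y & kaug j y = 0.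
Proof.
move=> ij hz z0; have -> : j = i - 1 by rewrite ij addrK.
have [|y -> y0] := @kcomplex_exact n k G (enum 'I_n) i z hz.
  move=> g h hg m hm; have g0 : g = set0.
    by apply/setP => v; rewrite inE; apply/negbTE/hg; rewrite mem_enum.
  subst g; have : pvalid G (set0, h) && (#|h|%:Z == i).
    by apply: contraLR hm => H; rewrite kext_out ?msupp0.
  rewrite pvalid_0 => /andP[hG /eqP hi].
  have [v vh mv] := fq_indep nuP z0 hG hi hm.
  by exists v; rewrite mem_enum.
exists y => //; apply: big1 => h _; rewrite y0 scale0r //.
Qed.

Lemma kaug_surj i (y : N i) : exists z, y = kaug i z.
Proof.
have [c ->] := fq_span nuP y; exists (kres G i (fun _ h => c h)).
apply: eq_bigr => h _; rewrite kext_res pvalid_0; case: ifP => // hG.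
by rewrite (fq_out nuP) ?hG // !scaler0.
Qed.

Lemma kaug_quasi_iso : quasi_iso kaug.
Proof.
apply/quasi_isoP => i; split.
  move=> z hz [j [y e]]; have [w ew] := kaug_surj y.
  rewrite -[z](subrK (cdiff K j i w)); apply: coboundaryD; last by exists j, w.
  have [|||y' -> _] := @kaug_exact i (i - 1) (z - cdiff K j i w); last by exists (i - 1), y'.
  - by rewrite subrK.
  - by apply: cocycleB => //; apply: coboundary_cocycle; exists j, w.
  - by rewrite linearB /= kaug_chain_map e ew subrr.
move=> y hy; have [z ez] := kaug_surj y.
have [||w ew w0] := @kaug_exact (i + 1) i (cdiff K i (i + 1) z) erefl.
- by apply: coboundary_cocycle; exists i, z.
- by rewrite kaug_chain_map -ez.
exists (z - w); last by rewrite linearB /= w0 subr0 ez subrr; apply: coboundary0.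
by apply: cocycleP erefl _; rewrite linearB /= ew subrr.
Qed.

End PairComplexAugmentation.

(** * Square free modules and Alexander duality *)

Section SquareFree.
Variables (n : nat) (k : fieldType).
Local Notation S := {mpoly k[n]}.
Implicit Types (v w : 'I_n) (R : {set 'I_n}) (b c m : 'X_{1..n}).

Definition supp b : {set 'I_n} := [set v | b v != 0%N].

Lemma sq0 : sq (set0 : {set 'I_n}) = 0%MM.
Proof. by apply/mnmP => v; rewrite !mnmE inE. Qed.

Lemma sq_setU1 v R : v \notin R -> sq (v |: R) = (U_(v) + sq R)%MM.
Proof.
move=> vR; apply/mnmP => x; rewrite !mnmE !inE eq_sym.
by case: eqVneq => [<-|_] //=; rewrite (negPf vR).
Qed.

Lemma sq_setC R : (sq R + sq (~: R))%MM = sq setT.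
Proof. by apply/mnmP => x; rewrite !mnmE !inE; case: (x \in R). Qed.

Lemma supp_sq_le b : (sq (supp b) <= b)%MM.
Proof. by apply/mnm_lepP => x; rewrite !mnmE inE; case: (b x). Qed.

Lemma hcomp_sum_seq (M : gmod n k) (I : Type) (r : seq I) (F : I -> M) b :
  hcomp b (\sum_(i <- r) F i) = \sum_(i <- r) hcomp b (F i).
Proof.
apply: (big_morph _ (hcompD b)); have := hcomp_id b (grade0 M b).
by rewrite eqxx.
Qed.

Lemma hcomp_scale (M : gmod n k) (p : S) (x : M) b :
  grade 0%MM x -> hcomp b (p *: x) = (p@_b)%:MP *: ('X_[b] *: x).
Proof.
move=> hx; rewrite {1}[p]mpolyE scaler_suml hcomp_sum_seq.
have E m : hcomp b ((p@_m *: 'X_[m] : S) *: x) =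
    if b == m then (p@_b)%:MP *: ('X_[b] *: x) else 0.
  have := hcomp_id b (grade_monom p@_m m hx); rewrite addm0 => ->.
  by case: eqP => // <-; rewrite scalerA mul_mpolyC.
under eq_bigr => m _ do rewrite E.
have [bp|bp] := boolP (b \in msupp p).
  rewrite (bigD1_seq b) ?msupp_uniq //= eqxx big1 ?addr0 // => m /negPf.
  by rewrite eq_sym => ->.
rewrite big_seq big1 => [|m mp]; last by case: eqP => // e; rewrite e mp in bp.
by move: bp; rewrite -mcoeff_eq0 => /eqP->; rewrite mpolyC0 scale0r.
Qed.

Section SquareFreeModule.
Variable N : gmod n k.
Hypothesis sN : sqfree N.

Lemma sqfree_mulX c b (u : N) : (forall v, c v != 0%N -> b v != 0%N) ->
  grade (c + b)%MM u -> exists! w : N, grade b w /\ 'X_[c] *: w = u.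
Proof.
move: {2}(mdeg c) (erefl (mdeg c)) => d; elim: d c u => [|d IH] c u dc cb hu.
  move/eqP: dc; rewrite mdeg_eq0 => /eqP c0; subst c; rewrite add0m in hu.
  exists u; split => [|w [_ <-]]; first by rewrite mpolyX0 scale1r.
  by rewrite mpolyX0 scale1r.
have [v cv] : exists v, c v != 0%N.
  apply/existsP; apply: contra_eqT dc => /existsPn h.
  suff -> : c = 0%MM by rewrite mdeg0.
  by apply/mnmP => v; rewrite mnmE; apply/eqP; rewrite -[_ == _]negbK h.
pose c' := (c - U_(v))%MM; have ec : c = (U_(v) + c')%MM.
  by rewrite addmC submK // lep1mP.
have dc' : mdeg c' = d by move: dc; rewrite ec mdegD mdeg1 => -[].
rewrite ec -addmA in hu.
have bv : (c' + b)%MM v != 0%N by rewrite mnmE addn_eq0 negb_and (cb v cv) orbT.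
have [w1 [[hw1 e1] u1]] := sN bv hu.
have [|w [[hw e] uw]] := IH c' w1 dc' _ hw1.
  by move=> x xc; apply: cb; rewrite ec mnmE addn_eq0 negb_and xc orbT.
have eX (z : N) : 'X_[c] *: z = 'X_v *: ('X_[c'] *: z).
  by rewrite ec mpolyXD scalerA.
exists w; split => [|w' [hw' e']]; first by rewrite eX e e1.
apply: uw; split => //; apply/esym/u1; rewrite -eX; split => //.
exact: (gr_X (gradeP N)).
Qed.

Lemma sqfree_desc b (u : N) : grade b u ->
  exists w : N, grade (sq (supp b)) w /\ u = 'X_[b - sq (supp b)] *: w.
Proof.
move=> hu; rewrite -{1}[b](submK (supp_sq_le b)) in hu.
have [|w [[hw <-] _]] := sqfree_mulX _ hu.
  by move=> v; rewrite !mnmE inE; case: (b v).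
by exists w.
Qed.

Lemma sqfree_mulX_inj c b (w : N) : (forall v, c v != 0%N -> b v != 0%N) ->
  grade b w -> 'X_[c] *: w = 0 -> w = 0.
Proof.
move=> cb hw e; have [x [_ ux]] := sqfree_mulX cb (grade0 N (c + b)%MM).
rewrite -(ux w) // (ux 0) //; split; [exact: grade0 | exact: scaler0].
Qed.

End SquareFreeModule.

Lemma klin0 (M : gmod n k) b (f : M -> k) : klinear_on b f -> f 0 = 0.
Proof.
move=> hf; have := hf 1 0 0 (grade0 M b) (grade0 M b).
by rewrite scaler0 addr0 mul1r => /eqP; rewrite -subr_eq0 opprD addNKr oppr_eq0 => /eqP.
Qed.

Lemma klinD (M : gmod n k) b (f : M -> k) (u v : M) : klinear_on b f ->
  grade b u -> grade b v -> f (u + v) = f u + f v.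
Proof. by move=> hf hu hv; have := hf 1 u v hu hv; rewrite scale1r mul1r. Qed.

Lemma klinZ (M : gmod n k) b (f : M -> k) a (u : M) : klinear_on b f ->
  grade b u -> f (a%:MP *: u) = a * f u.
Proof.
move=> hf hu; have := hf a u 0 hu (grade0 M b).
by rewrite addr0 (klin0 hf) addr0.
Qed.

Lemma klinB (M : gmod n k) b (f : M -> k) (u v : M) : klinear_on b f ->
  grade b u -> grade b v -> f (u - v) = f u - f v.
Proof.
move=> hf hu hv; rewrite (klinD hf) //; last exact: gradeN.
congr (_ + _); rewrite -[- v]scaleN1r.
have -> : (-1 : S) = (-1)%:MP by rewrite mpolyCN.
by rewrite (klinZ _ hf) // mulN1r.
Qed.

Lemma klin_sum (M : gmod n k) b (f : M -> k) (I : Type) (r : seq I) (P : pred I)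
    (F : I -> M) : klinear_on b f -> (forall i, P i -> grade b (F i)) ->
  f (\sum_(i <- r | P i) F i) = \sum_(i <- r | P i) f (F i).
Proof.
move=> hf hF; elim: r => [|i r IH]; first by rewrite !big_nil (klin0 hf).
rewrite !big_cons; case: ifP => // Pi; rewrite (klinD hf) ?IH //; first exact: hF.
exact: grade_sum.
Qed.

Section AlexanderDualModule.
Variables (M N : gmod n k) (pair : {set 'I_n} -> N -> M -> k).
Hypothesis adP : alexander_dual pair.

Lemma ad_inj R (x : N) : grade (sq R) x ->
  (forall u, grade (sq (~: R)) u -> pair R x u = 0) -> x = 0.
Proof.
move=> hx h; have [|y [_ uy]] := @ad_perfect _ _ _ _ _ adP R (fun=> 0).
  by move=> a u v _ _; rewrite mulr0 addr0.
rewrite -(uy x) // (uy 0) //; split => [|u hu]; first exact: grade0.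
exact: klin0 (ad_linl adP hu).
Qed.

Lemma ad_eq R (x y : N) : grade (sq R) x -> grade (sq R) y ->
  (forall u, grade (sq (~: R)) u -> pair R x u = pair R y u) -> x = y.
Proof.
move=> hx hy h; apply/eqP; rewrite -subr_eq0; apply/eqP/(@ad_inj R).
  by apply: gradeD => //; apply: gradeN.
by move=> u hu; rewrite (klinB (ad_linl adP hu)) ?h ?subrr.
Qed.

Lemma grade_sqX R (W : gmod n k) (x : W) :
  grade (sq set0) x -> grade (sq R) ('X_[sq R] *: x).
Proof. by move=> hx; have := gr_X (gradeP W) (sq R) hx; rewrite sq0 addm0. Qed.

(** Moves the computation to the component of [M] in degree $V$, so one functional there determines
    the pairings of all square free multiples of [x]. *)
Lemma ad_mul_sq R (x : N) (u : M) : grade (sq set0) x -> grade (sq (~: R)) u ->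
  pair R ('X_[sq R] *: x) u = pair set0 x ('X_[sq R] *: u).
Proof.
move: {2}#|R| (erefl #|R|) => d; elim: d R u => [|d IH] R u dR hx hu.
  by move/eqP: dR; rewrite cards_eq0 => /eqP ->; rewrite sq0 mpolyX0 !scale1r.
have [v vR] : exists v, v \in R by apply/set0Pn; rewrite -cards_eq0 dR.
have vR' : v \notin R :\ v by rewrite !inE eqxx.
have eR : sq R = (U_(v) + sq (R :\ v))%MM by rewrite -sq_setU1 ?setD1K.
have hu' : grade (sq (~: (R :\ v))) ('X_v *: u).
  have -> : sq (~: (R :\ v)) = (U_(v) + sq (~: R))%MM.
    rewrite -sq_setU1; last by rewrite inE vR.
    by congr sq; apply/setP => y; rewrite !inE; case: eqVneq => [->|].
  exact: (gr_X (gradeP M)).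
rewrite eR mpolyXD -!scalerA -{1}(setD1K vR) (ad_mul adP) //; last by rewrite setD1K.
  rewrite IH //; first by rewrite !scalerA mulrC.
  by move: dR; rewrite (cardsD1 v) vR => -[].
exact: grade_sqX.
Qed.

End AlexanderDualModule.
End SquareFree.

(** * The Alexander dual of the enriched chain complex *)

Section EnrichedDual.
Variables (n : nat) (k : fieldType) (G : scomplex n).
Local Notation S := {mpoly k[n]}.
Implicit Types (v w : 'I_n) (R f h : {set 'I_n}) (i j : int).

Definition ecoef j (u : echain k G j) f : S :=
  if insub f is Some x then u x else 0.

Lemma ecoef_val j (u : echain k G j) (x : face G j) : ecoef u (face_set x) = u x.
Proof. by rewrite /ecoef /face_set valK. Qed.

Lemma ecoef_out j (u : echain k G j) f :
  ~~ ((f \in faces G) && (#|f|%:Z == j + 1)) -> ecoef u f = 0.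
Proof. by move=> H; rewrite /ecoef insubN. Qed.

Lemma ecoefD j (u v : echain k G j) f : ecoef (u + v) f = ecoef u f + ecoef v f.
Proof. by rewrite /ecoef; case: insub => [x|]; rewrite ?addr0 // ffunE. Qed.

Lemma ecoefZ j a (u : echain k G j) f : ecoef (a *: u) f = a * ecoef u f.
Proof. by rewrite /ecoef; case: insub => [x|]; rewrite ?mulr0 // ffunE. Qed.

Lemma ecoef_klinear j b f m : @klinear_on n k (echain k G j) b (fun u => (ecoef u f)@_m).
Proof. by move=> a u v _ _; rewrite ecoefD ecoefZ mcoeffD mul_mpolyC mcoeffZ. Qed.

Lemma ecoef_diff i j (u : echain k G i) f : f \in faces G -> #|f|%:Z = j + 1 ->
  i = j + 1 ->
  ecoef (ediff j u) f = \sum_(v | v \notin f) eps k v f * ('X_v * ecoef u (v |: f)).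
Proof.
move=> fG fj ij; rewrite {1}/ecoef insubT ?fG ?fj ?eqxx // => H.
rewrite ffunE /face_set /=.
pose T (g : {set 'I_n}) : S := (incidence f g)%:~R * 'X_[sq g - sq f] * ecoef u g.
transitivity (\sum_(g : {set 'I_n}) T g).
  rewrite [RHS](bigID (fun g => (g \in faces G) && (#|g|%:Z == i + 1))) /=.
  rewrite [X in _ = _ + X]big1 ?addr0 => [|g Hg]; last by rewrite /T ecoef_out ?mulr0.
  rewrite (big_sub (fun g => (g \in faces G) && (#|g|%:Z == i + 1)) T).
  by apply: eq_bigr => x _; rewrite /T -[X in ecoef u X]/(face_set x) ecoef_val.
transitivity (\sum_(g : {set 'I_n}) \sum_(v in g | f == g :\ v)
    eps k v f * ('X_v * ecoef u g)).
  apply: eq_bigr => g _; rewrite /T /incidence rmorph_sum /= !mulr_suml.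
  apply: eq_bigr => v /andP[vg /eqP ef].
  rewrite rmorphXn rmorphN1 -mulrA; congr (_ * _).
    by rewrite ef eps_del // sgvv mul1r.
  congr ('X_[_] * _); apply/mnmP => x; rewrite ef !mnmE !inE eq_sym.
  by case: eqVneq => [<-|_] /=; rewrite ?vg ?subnn.
rewrite (eq_bigr (fun g : {set 'I_n} => \sum_(v in g)
    if f == g :\ v then eps k v f * ('X_v * ecoef u g) else 0)); last first.
  by move=> g _; rewrite -big_mkcondr.
rewrite (exchange_big_dep predT) //= [RHS]big_mkcond; apply: eq_bigr => v _.
rewrite sum_setU1; case: (boolP (v \in f)) => vf /=.
  apply: big1 => g vg; rewrite setU1K //; case: eqP => // e.
  by rewrite e (negPf vg) in vf.
rewrite (bigD1 f) //= setU1K // eqxx big1 ?addr0 // => g /andP[vg gf].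
by rewrite setU1K // eq_sym (negPf gf).
Qed.

(** For faces [f] of dimension [j] disjoint from [R], these $x^{V\setminus(R\cup f)}f$ are a
    $k$-basis of the component of degree $V\setminus R$. *)
Definition ecell j R f : echain k G j :=
  [ffun x : face G j => if face_set x == f then 'X_[sq (~: (R :|: f))] else 0].

Lemma ecoef_cell j R f h : ecoef (ecell j R f) h =
  if (h \in faces G) && (#|h|%:Z == j + 1) && (h == f) then 'X_[sq (~: (R :|: f))] else 0.
Proof.
rewrite /ecoef; case: insubP => [x -> e|/negPf-> //].
by rewrite ffunE /face_set e.
Qed.

Lemma ecell_grade j R f : [disjoint R & f] -> grade (sq (~: R)) (ecell j R f).
Proof.
move=> d x; rewrite ffunE; case: eqP => [->|_] m; last by rewrite msupp0.
rewrite msuppX inE => /eqP->; apply/mnmP => y; rewrite !mnmE !inE.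
have := pred0P d y => /=.
by case: (y \in R); case: (y \in f).
Qed.

Variables (N : gcomplex n k)
  (pair : forall i, {set 'I_n} -> N i -> chain_shift (enriched k G) (- i) -> k).
Hypothesis adc : alexander_dual_complex pair.

(** The term of $\mathcal{E}[-1]$ paired with [N i] has faces of dimension $-(-i+1)=i-1$, that is,
    with $i$ elements. The functional is the dual basis vector of $x^{V\setminus h}h$ in degree
    $V$. *)
Definition nu_axiom i h (x : N i) := grade (sq set0) x /\
  forall u, grade (sq (~: set0)) u ->
    pair set0 x u = (@ecoef (- (- i + 1)) u h)@_(sq (~: h)).

Lemma nu_exists i h : exists x : N i, nu_axiom h x.
Proof.
have [|x [hx _]] := ad_perfect (adc_term adc i)
    (R := set0) (f := fun u => (@ecoef (- (- i + 1)) u h)@_(sq (~: h))).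
  exact: ecoef_klinear.
by exists x.
Qed.

Definition nu i h : N i := projT1 (cid (nu_exists i h)).

Lemma nu_grade i h : grade (sq set0) (nu i h).
Proof. by rewrite /nu; case: cid => x []. Qed.

Lemma pair_nu i h u : grade (sq (~: set0)) u ->
  pair set0 (nu i h) u = (@ecoef (- (- i + 1)) u h)@_(sq (~: h)).
Proof. by rewrite /nu; case: cid => x [] /= _; apply. Qed.

(** So $x^R\nu_h$ is the dual basis vector of [ecell _ R h] when [h] is a face with $i$ elements
    disjoint from [R], and it is zero when [h] meets [R]: this yields both the relations and the
    independence in [face_quotients]. *)
Lemma pair_nuX i h R u : grade (sq (~: R)) u ->
  pair R ('X_[sq R] *: nu i h) u =
    if [disjoint R & h] then (@ecoef (- (- i + 1)) u h)@_(sq (~: (R :|: h))) else 0.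
Proof.
move=> hu; rewrite (ad_mul_sq (adc_term adc i)) //; last exact: nu_grade.
rewrite pair_nu; last first.
  have -> : sq (~: set0) = (sq R + sq (~: R))%MM by rewrite sq_setC setC0.
  exact: (gr_X (gradeP _)).
rewrite ecoefZ; case: ifP => d.
  have -> : sq (~: h) = (sq R + sq (~: (R :|: h)))%MM.
    apply/mnmP => y; rewrite !mnmE !inE; have := pred0P d y => /=.
    by case: (y \in R); case: (y \in h).
  by rewrite mulrC mcoeffMX.
apply/eqP; rewrite mulrC mcoeff_eq0 (perm_mem (msuppMX _ _)).
apply/negP => /mapP[m _ e]; move/negP: d; apply; apply/pred0P => y /=.
move/mnmP/(_ y): e; rewrite !mnmE !inE.
by case: (y \in R); case: (y \in h).
Qed.

Lemma pair_nu_sum i R (a : {set 'I_n} -> k) u : grade (sq (~: R)) u ->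
  pair R (\sum_h (a h)%:MP *: ('X_[sq R] *: nu i h)) u =
  \sum_h a h * pair R ('X_[sq R] *: nu i h) u.
Proof.
move=> hu; have kl := ad_linl (adc_term adc i) hu.
have gX h : grade (sq R) ('X_[sq R] *: nu i h) by apply/grade_sqX/nu_grade.
rewrite (klin_sum _ kl) => [|h _]; last by apply: gradeZ.
by apply: eq_bigr => h _; rewrite (klinZ _ kl).
Qed.

Lemma echain_cells j R (u : echain k G j) : grade (sq (~: R)) u ->
  u = \sum_(h : {set 'I_n} | [disjoint R & h])
    ((ecoef u h)@_(sq (~: (R :|: h))))%:MP *: (ecell j R h : echain k G j).
Proof.
move=> hu; apply/ffunP => x; rewrite sum_ffunE.
have supx m : m \in msupp (u x) ->
    [disjoint R & face_set x] /\ m = sq (~: (R :|: face_set x)).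
  move=> hm; have e := hu x m hm; split.
    apply/pred0P => y /=; move/mnmP/(_ y): e; rewrite !mnmE !inE.
    by case: (y \in R); case: (y \in face_set x) => //=; rewrite addn1.
  apply/mnmP => y; move/mnmP/(_ y): e; rewrite !mnmE !inE.
  by case: (y \in R); case: (y \in face_set x) => //=; lia.
have E h : (((ecoef u h)@_(sq (~: (R :|: h))))%:MP *: (ecell j R h : echain k G j)) x =
    if h == face_set x then (u x)@_(sq (~: (R :|: h))) *: 'X_[sq (~: (R :|: h))] else 0.
  rewrite !ffunE eq_sym; case: eqP => [->|_]; last by rewrite scaler0.
  by rewrite ecoef_val; apply: mul_mpolyC.
under eq_bigr => h _ do rewrite E.
have [d|d] := boolP [disjoint R & face_set x].
  rewrite (bigD1 (face_set x)) //= eqxx big1 ?addr0 => [|h /andP[_ /negPf->] //].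
  apply/mpolyP => m; rewrite mcoeffZ mcoeffX.
  case: eqVneq => [<-|em]; rewrite ?mulr1 // mulr0; apply/eqP; rewrite mcoeff_eq0.
  by apply/negP => /supx[_ e]; rewrite e eqxx in em.
rewrite big1 => [|h dh]; last by case: eqP => // e; rewrite -e dh in d.
apply/mpolyP => m; rewrite mcoeff0; apply/eqP; rewrite mcoeff_eq0.
by apply/negP => /supx[dx _]; rewrite dx in d.
Qed.

Lemma nu_span i b (y : N i) : grade b y ->
  exists c : {set 'I_n} -> S, y = \sum_h c h *: nu i h.
Proof.
move=> /(sqfree_desc (ad_sqfree (adc_term adc i)))[x [hx ->]]; set R := supp b in hx *.
pose j := - (- i + 1).
pose cell h : chain_shift (enriched k G) (- i) :=
  if [disjoint R & h] then ecell j R h else (0 : echain k G j).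
have gcell h : grade (sq (~: R)) (cell h).
  by rewrite /cell; case: ifP => [d|_]; [exact: ecell_grade|exact: grade0].
pose a h := pair R x (cell h).
(* Expansion of [x] in the basis dual to the cells of degree $V\setminus R$. *)
suff -> : x = \sum_h (a h)%:MP *: ('X_[sq R] *: nu i h).
  exists (fun h => 'X_[b - sq R] * ((a h)%:MP * 'X_[sq R])).
  by rewrite scaler_sumr; apply: eq_bigr => h _; rewrite !scalerA !mulrA.
apply: (ad_eq (adc_term adc i) hx) => [|u hu].
  by apply: grade_sum => h _; apply/gradeZ/grade_sqX/nu_grade.
rewrite pair_nu_sum // [in LHS](@echain_cells j R u hu).
rewrite (klin_sum _ (ad_linr (adc_term adc i) hx)); last first.
  by move=> h d; apply: gradeZ; apply: ecell_grade.
rewrite [RHS](bigID (fun h : {set 'I_n} => [disjoint R & h])) /=.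
rewrite [X in _ = _ + X]big1 ?addr0; last first.
  by move=> h /negPf d; rewrite pair_nuX // d mulr0.
apply: eq_bigr => h d; rewrite (klinZ _ (ad_linr (adc_term adc i) hx)); last exact: ecell_grade.
by rewrite pair_nuX // d mulrC /a /cell d.
Qed.

Lemma nu_face_quotients : face_quotients G nu.
Proof.
have ei i : - (- i + 1) + 1 = i by lia.
have epsE v h : eps k v h = ((-1) ^+ #|[set w in h | (w < v)%N]|)%:MP.
  by rewrite rmorphXn rmorphN1.
split.
- by move=> i h; rewrite -sq0; apply: nu_grade.
- move=> i h H; apply: (ad_inj (adc_term adc i) (nu_grade i h)) => u hu.
  by rewrite pair_nu // ecoef_out ?mcoeff0 // ei.
- move=> i h v vh; have e1 : sq [set v] = U_(v)%MM.
    by apply/mnmP => x; rewrite !mnmE !inE eq_sym.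
  rewrite -e1; apply: (ad_inj (adc_term adc i) (grade_sqX _ (nu_grade i h))) => u hu.
  rewrite pair_nuX //; case: ifP => // /pred0P /(_ v) /=.
  by rewrite !inE eqxx vh.
- move=> i h; apply: (ad_eq (adc_term adc (i + 1)) (R := set0)).
  + exact/cdiff_grade/nu_grade.
  + by apply: grade_sum => v _; rewrite epsE; apply/gradeZ/nu_grade.
  move=> u hu; rewrite (adc_diff adc) //; last exact: nu_grade.
  rewrite pair_nu; last exact: cdiff_grade.
  rewrite (klin_sum _ (ad_linl (adc_term adc (i + 1)) hu)); last first.
    by move=> v _; rewrite epsE; apply/gradeZ/nu_grade.
  have -> : \sum_(v | v \notin h) pair set0 (eps k v h *: nu (i + 1) (v |: h)) u =
      \sum_(v | v \notin h) (-1) ^+ #|[set w in h | (w < v)%N]| *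
         (@ecoef (- (- (i + 1) + 1)) u (v |: h))@_(sq (~: (v |: h))).
    apply: eq_bigr => v _.
    by rewrite epsE (klinZ _ (ad_linl (adc_term adc _) hu)) ?pair_nu //; apply: nu_grade.
  have [/andP[hG /eqP hi]|H] := boolP ((h \in faces G) && (#|h|%:Z == i)).
    rewrite [ecoef _ _]ecoef_diff ?ei //; last by lia.
    rewrite raddf_sum; apply: eq_bigr => v vh /=.
    rewrite epsE mul_mpolyC mcoeffZ mcoeffXM !mnmE !inE vh /=; congr (_ * _@_(_)).
    apply/mnmP => x; rewrite !mnmE !inE eq_sym.
    by case: eqVneq => [->|_] /=; rewrite ?vh ?subn0.
  rewrite ecoef_out ?ei // mcoeff0 big1 // => v vh.
  rewrite ecoef_out ?mcoeff0 ?mulr0 //; apply: contra H => /andP[vhG vhi].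
  rewrite (facesP vhG (subsetUr _ _)) /=; move: vhi; rewrite cardsU1 vh.
  by move: #|h| => c; lia.
- move=> i y; have [s [_ ->]] := hcomp_sum y.
  have hom b : exists c : {set 'I_n} -> S, hcomp b y = \sum_h c h *: nu i h.
    exact/nu_span/grade_hcomp.
  have [c hc] := choice hom; exists (fun h => \sum_(b <- undup s) c b h).
  under eq_bigr => b _ do rewrite hc.
  by rewrite exchange_big; apply: eq_bigr => h _; rewrite scaler_suml.
- move=> i c e0 h hG hi m hm; apply: contrapT => hn.
  have d : [disjoint supp m & h].
    apply/pred0P => v /=; rewrite inE; apply/negP => /andP[mv vh].
    by apply: hn; exists v.
  set R := supp m in d *.
  (* The component of degree [m] of the relation, divided by $x^{m-R}$, which a square free module
     permits; pairing it with the cell of [h] extracts the coefficient of [m] in [c h]. *)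
  pose x := \sum_h' ((c h')@_m)%:MP *: ('X_[sq R] *: nu i h').
  have x0 : x = 0.
    apply: (sqfree_mulX_inj (c := (m - sq R)%MM) (b := sq R) (ad_sqfree (adc_term adc i))).
    + by move=> v; rewrite !mnmE inE; case: (m v).
    + by apply: grade_sum => h' _; apply/gradeZ/grade_sqX/nu_grade.
    have := congr1 (hcomp m) e0; rewrite hcomp_sum_seq.
    rewrite hcomp0.
    move=> <-; rewrite scaler_sumr; apply: eq_bigr => h' _.
    rewrite hcomp_scale; last by rewrite -sq0; apply: nu_grade.
    have -> : 'X_[m] = 'X_[m - sq R] * 'X_[sq R] :> S.
      by rewrite -mpolyXD submK // supp_sq_le.
    by rewrite !scalerA mulrCA mulrA.
  have gc := @ecell_grade (- (- i + 1)) R h d.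
  have := congr1 (fun x => pair R x (ecell (- (- i + 1)) R h)) x0.
  rewrite (klin0 (ad_linl (adc_term adc i) gc)) pair_nu_sum //.
  rewrite (bigD1 h) //= big1 ?addr0 => [|h' /negPf h'h]; last first.
    rewrite pair_nuX //; case: ifP; rewrite ?mulr0 //.
    by rewrite ecoef_cell h'h andbF mcoeff0 mulr0.
  rewrite pair_nuX // d ecoef_cell hG eqxx ei hi eqxx /= mcoeffX eqxx mulr1.
  by apply/eqP; rewrite -mcoeff_msupp.
Qed.

End EnrichedDual.

(** * Resolution of the Stanley-Reisner ideal *)

Section DualResolution.
Variables (n : nat) (k : fieldType) (G : scomplex n).
Local Notation S := {mpoly k[n]}.
Local Notation K := (kcomplex k G).
Local Notation W := (omegaS n k).
Variables (N : gcomplex n k) (nu : forall i, {set 'I_n} -> N i).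
Hypothesis nuP : face_quotients G nu.
Variables (Q : fsq_complex n k) (phi : forall i, {linear Q i -> N i}).
Hypotheses (phiP : cmorphism phi) (phiQ : quasi_iso phi).

Definition dual_cocycle i (f : homS (Q i) W) :=
  forall j (z : Q j), homS_fun f (cdiff Q j i z) = 0.

Lemma dual_coboundary0 i (f : homS (Q i) W) (u : Q i) :
  dual_cocycle f -> coboundary u -> homS_fun f u = 0.
Proof. by move=> hf [j [x ->]]; apply: hf. Qed.

(** Carries the results on $\mathrm{Hom}(K,\omega_S)$ over to [Q]. The index [j] is kept apart from
    [i + 1] so that the statement fits the terms of [D Q], where it becomes [- (i - 1)]. *)
Lemma dual_cohomology : exists q : Q 0,
  [/\ grade (sq setT) q, cocycle q,
      forall i j (f : homS (Q i) W), j = i + 1 -> i != 0 -> dual_cocycle f ->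
        exists e : homS (Q j) W, f = precomp (cdiff Q i j) e,
      forall j (f : homS (Q 0) W), j = 1 -> dual_cocycle f -> homS_fun f q = 0 ->
        exists e : homS (Q j) W, f = precomp (cdiff Q 0 j) e
    & forall p : S^o, p \in @in_SR_ideal n k (alexander_complex G) <->
        exists2 f : homS (Q 0) W, dual_cocycle f & p = homS_fun f q].
Proof.
have cphi : chain_map phi := cmor_comm phiP.
have caug := kaug_chain_map nuP.
have [beta cb hb] := lift_through_quasi_iso cphi phiQ caug.
have qb : quasi_iso beta.
  exact: quasi_iso_cancel cphi caug cb phiQ (kaug_quasi_iso nuP) hb.
(* Lifting the identity of [Q] through [beta] gives a homotopy inverse on one side; injectivity of
   [beta] on cohomology supplies what is needed on the other. *)
have [|alpha ca [s hs]] := lift_through_quasi_iso cb qb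
    (psi := fun i => idfun : {linear Q i -> Q i}) _ => //.
have hab : homotopy_eq (fun i => idfun : {linear Q i -> Q i})
    (fun i => beta i \o alpha i : {linear Q i -> Q i}) by exists s.
set z := kcycle k G; have zz : cocycle z := @kcycle_cocycle n k G.
(* [beta] is not known to preserve multidegrees, hence the component; [q0 - q] is a coboundary
   because its image under [phi] is one. *)
pose q0 := beta 0 z; pose q := hcomp (sq setT) q0.
have zq0 : cocycle q0 := chain_map_cocycle cb zz.
have zq : cocycle q.
  by move=> j; rewrite /q -(hcomp_morph (@cdiff_grade _ _ Q 0 j)) zq0 hcomp0.
have q0q : coboundary (q0 - q).
  apply: ((quasi_isoP phi).1 phiQ 0).1; first exact: cocycleB.
  have [j [y hy]] := homotopy_eq_cocycle hb zz.
  have gz : grade (sq setT) (kaug G nu 0 z) by apply: (kaug_grade nuP); apply: kcycle_grade.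
  exists j, (hcomp (sq setT) y - y); rewrite [RHS]linearB /= -hy.
  rewrite -(hcomp_morph (@cdiff_grade _ _ N j 0)) -hy hcompB (hcomp_id _ gz) eqxx /=.
  rewrite (hcomp_morph (cmor_grade phiP (i := 0))) -/q -/q0 linearB /=.
  have AC (V : zmodType) (a b c : V) : a - b = c - b - (c - a).
    by rewrite opprB [RHS]addrC addrA subrK.
  exact: AC.
have fq (f : homS (Q 0) W) : dual_cocycle f -> homS_fun f q = homS_fun (precomp (beta 0) f) z.
  move=> zf; apply/eqP; rewrite eq_sym -subr_eq0; apply/eqP.
  have := dual_coboundary0 zf q0q; rewrite linearB; exact.
have main i (f : homS (Q i) W) (e0 : homS (K (i + 1)) W) : dual_cocycle f ->
    precomp (beta i) f = precomp (cdiff K i (i + 1)) e0 ->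
    exists e : homS (Q (i + 1)) W, f = precomp (cdiff Q i (i + 1)) e.
  move=> zf he0; exists (precomp (alpha (i + 1)) e0 + precomp (s (i + 1) i) f).
  apply: homSP => u.
  have e1 : homS_fun f (beta i (alpha i u)) =
      homS_fun e0 (alpha (i + 1) (cdiff Q i (i + 1) u)).
    by rewrite ca; apply: (congr1 (fun g => homS_fun g (alpha i u)) he0).
  have e2 : homS_fun f u - homS_fun f (beta i (alpha i u)) =
      homS_fun f (s (i + 1) i (cdiff Q i (i + 1) u)).
    by rewrite -linearB [u - _](hs i u) linearD /= zf add0r.
  rewrite [RHS](_ : _ = homS_fun e0 (alpha (i + 1) (cdiff Q i (i + 1) u)) +
    homS_fun f (s (i + 1) i (cdiff Q i (i + 1) u))) //.
  by rewrite -e1 -e2 addrC subrK.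
exists q; split => //.
- exact: grade_hcomp.
- move=> i j f -> i0 zf.
  have [|e0 he0] := @kcomplex_dual_exact n k G i (precomp (beta i) f) i0.
    by move=> l x; rewrite -[LHS]/(homS_fun f (beta i (cdiff K l i x))) cb; apply: zf.
  exact: main zf he0.
- move=> j f -> zf f0.
  have [|e0 he0] := @kcomplex_dual_exact0 n k G (precomp (beta 0) f).
    by rewrite -fq.
  exact: (main 0 f e0).
- move=> p; rewrite kcycle_image; split => [[f ->]|[f zf ->]]; last first.
    by exists (precomp (beta 0) f); rewrite fq.
  have zf : forall j (x : K j), homS_fun f (cdiff K j 0 x) = 0.
    move=> j x; have [j0|j0] := eqVneq j (-1); last first.
      by rewrite cdiff_shape ?linear0 //; move: j0; lia.
    by rewrite (kterm_out x) ?linear0 // j0.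
  exists (precomp (alpha 0) f).
    by move=> j x; rewrite -[LHS]/(homS_fun f (alpha 0 (cdiff Q j 0 x))) ca; apply: zf.
  (* [beta] maps this difference to a coboundary, since [beta \o alpha] is homotopic to the identity
     and [q] is cohomologous to [beta 0 z]. *)
  have : coboundary (alpha 0 q - z).
    apply: ((quasi_isoP beta).1 qb 0).1.
      by apply: cocycleB => //; apply: chain_map_cocycle.
    rewrite linearB /= -/q0.
    have h1 := homotopy_eq_cocycle hab zq; have := coboundaryD (coboundaryN h1) (coboundaryN q0q).
    by rewrite !opprB addrA subrK.
  move=> [j [x hx]]; have := zf j x; rewrite -hx linearB => /eqP.
  by rewrite subr_eq0 => /eqP.
Qed.

End DualResolution.

Section IdealResolution.
Variables (n : nat) (k : fieldType) (G : scomplex n).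
Local Notation S := {mpoly k[n]}.
Local Notation W := (omegaS n k).
Local Notation Gs := (alexander_complex G).

Lemma D_resolves_ideal (Q : fsq_complex n k) :
  is_A (chain_shift (enriched k G)) Q ->
  minimal_free_resolution (D Q) (SR_ideal k Gs).
Proof.
move=> [mQ [N [pair [phi [adc phiP phiQ]]]]].
have [q [gq zq ex ex0 im]] := dual_cohomology (nu_face_quotients adc) phiP phiQ.
have cyc i (f : D Q i) : cocycle f -> dual_cocycle (f : homS (Q (- i)) W).
  move=> hf j; have [l ->] : exists l, j = - l by exists (- j); rewrite opprK.
  by move=> z; apply: (congr1 (fun g => homS_fun g z) (hf l)).
have mD := D_minimal mQ.
have exD i (f : D Q i) : i != 0 -> cocycle f -> coboundary f.
  move=> i0 hf; have [||e he] := ex (- i) (- (i - 1)) f _ _ (cyc i f hf).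
  - lia.
  - by rewrite oppr_eq0.
  - by exists (i - 1), e.
have D0 := minimal_exact_pos mD (fun i f i0 => @exD i f (lt0r_neq0 i0)).
(* Minimality has made the term in degree 1 vanish, so evaluation at [q] lands in the ideal on the
   whole term of degree 0. *)
have cyc0 (f : D Q 0) : dual_cocycle (f : homS (Q 0) W).
  by apply: (cyc 0 f); apply: (@cocycleP _ _ _ _ 1) => //; apply: D0.
split => //; split => //; split.
  move=> i i0 f hf; have e : i = (i - 1) + 1 by rewrite subrK.
  apply: (coboundaryP e); apply: exD; first by rewrite lt_eqF.
  exact: cocycleP hf.
have mem (f : D Q 0) : homS_fun f q \in @in_SR_ideal n k Gs.
  by apply/im; exists f.
pose aug (f : D Q 0) : SR_ideal k Gs := Sub (homS_fun f q) (mem f).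
have aug_lin : linear aug by move=> a f g; apply: val_inj.
pose augL : {linear D Q 0 -> SR_ideal k Gs} :=
  HB.pack aug (GRing.isLinear.Build _ _ _ _ aug aug_lin).
exists augL; split.
(* The degree $(1,\dots,1)$ of [q] cancels the shift in $\omega_S$. *)
- move=> b f hf m hm; have := hf _ _ gq m hm.
  move=> /(congr1 (fun x => x - sq setT)%MM); rewrite addmK addmC addmK => ->.
  by rewrite sq0 addm0.
- move=> y; have [f zf e] := (im (val y)).1 (valP y).
  by exists f; apply: val_inj.
- move=> f; split => [/(congr1 val) f0|[g ->]].
    by have [|e ->] := ex0 (- -1) f _ (cyc0 f) f0; [|exists e].
  by apply: val_inj; rewrite /= D_diffE zq linear0.
Qed.

End IdealResolution.

(** * Resolution of the Stanley-Reisner ring *)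

Section FunctionalExtension.
Variables (n : nat) (k : fieldType) (A B : gmod n k) (d : {linear A -> B}).
Variables (b : 'X_{1..n}) (F : A -> k).
Local Notation S := {mpoly k[n]}.
Hypotheses (FP : klinear_on b F)
  (F0 : forall u, grade b u -> d u = 0 -> F u = 0).

(** The $k$-subspace spanned by [T] and the image under [d] of the component of degree [b]. *)
Fixpoint image_plus (T : seq B) (x : B) : Prop :=
  if T is t :: T' then exists (c : k) (y : B), image_plus T' y /\ x = c%:MP *: t + y
  else exists u, grade b u /\ x = d u.

Lemma image_plus_lin T a x y :
  image_plus T x -> image_plus T y -> image_plus T (a%:MP *: x + y).
Proof.
elim: T x y => [|t T IH] x y /=.
  move=> [u [hu ->]] [v [hv ->]]; exists (a%:MP *: u + v).
  by split; [exact: grade_lin|rewrite linearP].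
move=> [c [x' [hx ->]]] [c' [y' [hy ->]]]; exists (a * c + c'), (a%:MP *: x' + y').
split; first exact: IH.
by rewrite scalerDr scalerA -mpolyCM addrACA -scalerDl -mpolyCD.
Qed.

Lemma image_plus_d T u : grade b u -> image_plus T (d u).
Proof.
move=> hu; elim: T => [|t T IH] /=; first by exists u.
by exists 0, (d u); rewrite mpolyC0 scale0r add0r.
Qed.

Lemma image_plusZ T a x : image_plus T x -> image_plus T (a%:MP *: x).
Proof.
move=> hx; have h0 : image_plus T 0 by rewrite -(linear0 d); apply/image_plus_d/grade0.
by have := image_plus_lin a hx h0; rewrite addr0.
Qed.

Lemma image_plusB T x y : image_plus T x -> image_plus T y -> image_plus T (x - y).
Proof.
move=> hx hy; have := image_plus_lin (-1) hy hx.
by rewrite mpolyCN scaleN1r addrC.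
Qed.

(* The functional [d u |-> F u] is extended to one more vector at a time. *)
Lemma functional_extends T : exists F' : B -> k,
  (forall a x y, image_plus T x -> image_plus T y ->
     F' (a%:MP *: x + y) = a * F' x + F' y) /\
  forall u, grade b u -> F' (d u) = F u.
Proof.
elim: T => [|t T [F' [lF' eF']]] /=.
  have wd u v : grade b u -> grade b v -> d u = d v -> F u = F v.
    move=> hu hv e; apply/eqP; rewrite -subr_eq0 -(klinB FP) //; apply/eqP/F0.
      by apply: gradeD => //; apply: gradeN.
    by rewrite linearB /= e subrr.
  pose F' x := if pselect (exists u, grade b u /\ x = d u) is left h
    then F (projT1 (cid h)) else 0.
  have eF u : grade b u -> F' (d u) = F u.
    move=> hu; rewrite /F'; case: pselect => [h|[]]; last by exists u.
    by case: cid => v [hv e] /=; apply: wd.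
  exists F'; split => // a _ _ [u [hu ->]] [v [hv ->]].
  by rewrite -linearP !eF ?FP //; apply: grade_lin.
have [tT|tT] := pselect (image_plus T t).
  exists F'; split => // a x y [c [x' [hx ->]]] [c' [y' [hy ->]]].
  by rewrite lF' //; apply: image_plus_lin.
(* The new vector [t] gets the value 0; as [t] is outside the subspace, the summand [y] of [x] is
   unique. *)
pose F2 x := if pselect (exists y, image_plus T y /\ exists c : k, x = c%:MP *: t + y)
  is left h then F' (projT1 (cid h)) else 0.
have eF c y : image_plus T y -> F2 (c%:MP *: t + y) = F' y.
  move=> hy; rewrite /F2; case: pselect => [h|[]]; last by exists y; split => //; exists c.
  case: cid => y' [hy' [c' e]] /=.
  have [cc|cc] := eqVneq c c'; first by move: e; rewrite cc => /addrI ->.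
  exfalso; apply: tT; have nz : c - c' != 0 by rewrite subr_eq0.
  have -> : t = ((c - c')^-1)%:MP *: (y' - y).
    have -> : y' - y = (c - c')%:MP *: t.
      apply/eqP; rewrite mpolyCB scalerBl subr_eq addrAC e addrAC subrr add0r //.
    by rewrite scalerA -mpolyCM mulVf // scale1r.
  exact/image_plusZ/image_plusB.
exists F2; split => [a x y [c [x' [hx ->]]] [c' [y' [hy ->]]]|u hu].
  rewrite !eF // scalerDr scalerA -mpolyCM addrACA -scalerDl -mpolyCD eF ?lF' //.
  exact: image_plus_lin.
have := eF 0 _ (image_plus_d T hu); rewrite mpolyC0 scale0r add0r => ->.
exact: eF'.
Qed.

(** The component of degree [b] of a free module is spanned by one monomial multiple of each basis
    element, so finitely many extensions exhaust it. *)
Lemma functional_lift : free_sqfree B -> exists F' : B -> k,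
  klinear_on b F' /\ forall u, grade b u -> F' (d u) = F u.
Proof.
move=> [I [deg [e eP]]].
pose t i := if (sq (deg i) <= b)%MM then 'X_[b - sq (deg i)] *: e i else 0.
have [F' [lF' eF']] := functional_extends [seq t i | i <- enum I].
suff U x : grade b x -> image_plus [seq t i | i <- enum I] x.
  by exists F'; split => // a x y /U hx /U hy; apply: lF'.
move=> hx; rewrite {1}[x](coordsE eP) in hx; have h := basis_grade eP hx.
have -> : x = \sum_(i <- enum I) ((coords eP x i)@_(b - sq (deg i)))%:MP *: t i.
  rewrite big_enum {1}[x](coordsE eP); apply: eq_bigr => i _; rewrite /t.
  have E m : m \in msupp (coords eP x i) -> m = (b - sq (deg i))%MM.
    by move=> /h <-; rewrite addmK.
  case: ifP => db.
    rewrite scalerA; congr (_ *: _); rewrite mul_mpolyC; apply/mpolyP => m.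
    rewrite mcoeffZ mcoeffX; case: eqVneq => [<-|bm]; rewrite ?mulr1 // mulr0.
    by apply/eqP; rewrite mcoeff_eq0; apply: contra bm => /E ->.
  rewrite scaler0 [coords eP x i](_ : _ = 0) ?scale0r //; apply/mpolyP => m.
  rewrite mcoeff0; apply/eqP; rewrite mcoeff_eq0; apply: contraFN db => /h <-.
  exact: lem_addl.
elim: (enum I) => [|i s IH].
  by rewrite big_nil; exists 0; rewrite linear0; split => //; apply: grade0.
by rewrite big_cons; do 2 eexists; split; first exact: IH.
Qed.

End FunctionalExtension.

(** * The Alexander dual of a resolution of the ideal *)

Section RingResolution.
Variables (n : nat) (k : fieldType) (G : scomplex n).
Local Notation S := {mpoly k[n]}.
Local Notation Gs := (alexander_complex G).
Implicit Types (b m : 'X_{1..n}) (R : {set 'I_n}).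

Variables (Y : fsq_complex n k) (N : gcomplex n k)
  (pair : forall i, {set 'I_n} -> N i -> Y (- i) -> k).
Hypothesis adc : alexander_dual_complex pair.

Let sN i : sqfree (N i) := ad_sqfree (adc_term adc i).

Lemma ad_zero i : (forall u : Y (- i), u = 0) -> forall y : N i, y = 0.
Proof.
move=> Y0 y; apply: hcomp0P => b.
have [w [hw ->]] := sqfree_desc (@sN i) (grade_hcomp b y).
rewrite (ad_inj (adc_term adc i) hw) ?scaler0 // => u _.
by rewrite (Y0 u) (klin0 (ad_linr (adc_term adc i) hw)).
Qed.

Lemma cocycle_hcomp i b (y : N i) : cocycle y -> cocycle (hcomp b y).
Proof. by move=> hy j; rewrite -(hcomp_morph (@cdiff_grade _ _ N i j)) hy hcomp0. Qed.

(* Square free modules are determined by their square free degrees: a cocycle of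
   degree [b] is a monomial multiple of one of degree [supp b]. *)
Lemma cocycle_desc i b (y : N i) : grade b y -> cocycle y ->
  exists2 w : N i, grade (sq (supp b)) w /\ cocycle w & y = 'X_[b - sq (supp b)] *: w.
Proof.
move=> hy zy; have [w [hw ew]] := sqfree_desc (@sN i) hy; exists w => //; split => // j.
apply: (sqfree_mulX_inj (@sN j) (c := (b - sq (supp b))%MM) (b := sq (supp b))).
- by move=> v; rewrite !mnmE inE; case: (b v).
- exact: cdiff_grade.
- by rewrite -linearZ /= -ew zy.
Qed.

(** Dualising over $k$ is exact. For a cocycle [w] of degree $R$, the functional [pair R w] kills
    the image of the incoming differential of [Y], which by exactness is the kernel of the outgoing
    one; it therefore factors through the latter, and an element representing the factor bounds
    [w]. *)
Lemma ad_exact i : (forall u : Y (- i), cocycle u -> coboundary u) ->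
  forall y : N i, cocycle y -> coboundary y.
Proof.
move=> exY y zy; have [s [_ ->]] := hcomp_sum y.
elim: (undup s) => [|b t IH]; first by rewrite big_nil; apply: coboundary0.
rewrite big_cons; apply: coboundaryD => {IH}//.
have [w [hw zw] ->] := cocycle_desc (grade_hcomp b y) (cocycle_hcomp b zy).
set R := supp b in hw *.
suff [j [x ->]] : coboundary w by exists j, ('X_[b - sq R] *: x); rewrite linearZ.
have lw := ad_linr (adc_term adc i) hw.
have [|F' [lF' eF']] := @functional_lift _ _ (Y (- i)) (Y (- (i - 1)))
    (cdiff Y (- i) (- (i - 1))) (sq (~: R)) (pair R w)
    lw _ (fsq_free Y _).
  move=> u hu du0; have [|j [x ex]] := exY u.
    by apply: (@cocycleP _ _ _ _ (- (i - 1))) => //; lia.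
  move: x ex; have [l ->] : exists l, j = - l by exists (- j); rewrite opprK.
  move=> x ex.
  have -> : u = cdiff Y (- l) (- i) (hcomp (sq (~: R)) x).
    by rewrite (hcomp_lift (@cdiff_grade _ _ Y (- l) (- i))) -?ex.
  rewrite -(adc_diff adc) //; last exact: grade_hcomp.
  by rewrite zw (klin0 (ad_linl (adc_term adc l) (grade_hcomp _ x))).
have [x [[hx ex] _]] := ad_perfect (adc_term adc (i - 1)) lF'.
exists (i - 1), x; apply: (ad_eq (adc_term adc i) hw); first exact: cdiff_grade.
by move=> u hu; rewrite (adc_diff adc) // ex ?eF' //; apply: cdiff_grade.
Qed.

Variable aug : {linear Y 0 -> SR_ideal k Gs}.
Hypotheses (aug_grade : forall b (u : Y 0), grade b u -> grade b (aug u))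
  (aug_surj : forall y, exists u, y = aug u)
  (aug_ker : forall u : Y 0, aug u = 0 <-> exists w : Y (-1), u = cdiff Y (-1) 0 w).

Definition augp (u : Y 0) : S := val (aug u).

Lemma augpD u v : augp (u + v) = augp u + augp v.
Proof. by rewrite /augp linearD. Qed.

Lemma augpZ a u : augp (a *: u) = a * augp u.
Proof. by rewrite /augp linearZ. Qed.

Lemma augp_grade R u : grade (sq (~: R)) u ->
  augp u = (augp u)@_(sq (~: R)) *: 'X_[sq (~: R)].
Proof.
move=> /aug_grade hu; apply/mpolyP => m; rewrite mcoeffZ mcoeffX.
case: eqVneq => [<-|em]; rewrite ?mulr1 // mulr0; apply/eqP; rewrite mcoeff_eq0.
by apply: contra em => /hu; rewrite sq0 addm0 => ->.
Qed.

(** $x^{V\setminus R}$ lies in the ideal of the dual complex exactly when $R$ is a face of $\Gamma$;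
    this lemma and [augp_exists] are the two directions. *)
Lemma augp_face R u : R \notin faces G -> grade (sq (~: R)) u -> augp u = 0.
Proof.
move=> RG hu; rewrite (augp_grade hu) [_@__](_ : _ = 0) ?scale0r //.
apply/eqP; rewrite mcoeff_eq0; apply: contra RG => /((SR_idealE _ _).1 (valP (aug u))).
case=> R'; rewrite inE negbK => R'G /mnm_lepP le; apply: facesP R'G _.
apply/subsetP => v vR; rewrite inE; have := le v; rewrite !mnmE !inE vR /=.
by case: (v \in R').
Qed.

Lemma augp_exists R : R \in faces G ->
  exists2 u, grade (sq (~: R)) u & augp u = 'X_[sq (~: R)].
Proof.
move=> RG; have XI : ('X_[sq (~: R)] : S^o) \in @in_SR_ideal n k Gs.
  apply/SR_idealE => m; rewrite msuppX inE => /eqP ->; exists (~: R); last exact: lepm_refl.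
  by rewrite inE setCK negbK.
pose y : SR_ideal k Gs := Sub ('X_[sq (~: R)] : S^o) XI.
have [u eu] := aug_surj y.
have gu : grade (sq (~: R)) (aug u).
  by rewrite -eu => m; rewrite /= msuppX inE => /eqP->; rewrite sq0 addm0.
exists (hcomp (sq (~: R)) u); first exact: grade_hcomp.
by rewrite /augp (hcomp_lift aug_grade gu) -eu.
Qed.

(** The image of 1 under the Alexander dual of [aug], a map from the dual of the ideal, which is
    $k[\Gamma]$, to [N 0]. *)
Lemma generator_exists : exists x : N 0, grade (sq set0) x /\
  forall u, grade (sq (~: set0)) u -> pair set0 x u = (augp u)@_(sq setT).
Proof.
have [|x [hx _]] := ad_perfect (adc_term adc 0)
    (R := set0) (f := fun u : Y (- 0) => (augp u)@_(sq setT)).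
  by move=> a u v _ _; rewrite augpD augpZ mcoeffD mul_mpolyC mcoeffZ.
by exists x.
Qed.

Definition ringgen : N 0 := projT1 (cid generator_exists).

Lemma ringgen_grade : grade (sq set0) ringgen.
Proof. by rewrite /ringgen; case: cid => x []. Qed.

Lemma pair_ringgen R (u : Y 0) : grade (sq (~: R)) u ->
  pair R ('X_[sq R] *: ringgen) u = (augp u)@_(sq (~: R)).
Proof.
move=> hu; rewrite (ad_mul_sq (adc_term adc 0) ringgen_grade hu) /ringgen; case: cid => x /= [_ ->].
  by rewrite augpZ -(sq_setC R) mulrC mcoeffMX.
have -> : sq (~: set0) = (sq R + sq (~: R))%MM by rewrite sq_setC setC0.
exact: (gr_X (gradeP _)).
Qed.

Lemma ringgen_cocycle : cocycle ringgen.
Proof.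
apply: (@cocycleP _ _ _ _ 1) => //; apply: (ad_inj (adc_term adc 1) (R := set0)).
  exact/cdiff_grade/ringgen_grade.
move=> u hu; rewrite (adc_diff adc) //; last exact: ringgen_grade.
have du : grade (sq (~: set0)) (cdiff Y (-1) 0 u) by apply: cdiff_grade.
have := pair_ringgen du; rewrite sq0 mpolyX0 scale1r => ->.
rewrite /augp (_ : aug _ = 0) ?mcoeff0 //.
by apply/aug_ker; exists u.
Qed.

(** $x^R$ kills the generator exactly when [augp] vanishes in degree $V\setminus R$, that is, when
    $R$ is a non-face; other monomials reduce to their supports because [N 0] is square free. *)
Lemma annihilator_ringgen (p : S) : p *: ringgen = 0 <-> (p : S^o) \in @in_SR_ideal n k G.
Proof.
split=> [e|/in_SR_idealP[c ->]]; last first.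
  rewrite scaler_suml big1 // => R RG; rewrite -scalerA.
  rewrite (ad_inj (adc_term adc 0) (grade_sqX R ringgen_grade)) ?scaler0 // => u hu.
  by rewrite (pair_ringgen hu) (augp_face RG hu) mcoeff0.
apply/SR_idealE => m hm; exists (supp m); last exact: supp_sq_le.
apply: contraTN hm => RG; set R := supp m in RG.
have := congr1 (hcomp m) e; rewrite hcomp0 hcomp_scale; last by rewrite -sq0; apply: ringgen_grade.
have -> : 'X_[m] = 'X_[m - sq R] * 'X_[sq R] :> S.
  by rewrite -mpolyXD submK // supp_sq_le.
rewrite -scalerA scalerA mulrC -scalerA => /(sqfree_mulX_inj (@sN 0)) h.
have {h} z : (p@_m)%:MP *: ('X_[sq R] *: ringgen) = 0.
  apply: (h (sq R)) => [v|]; first by rewrite !mnmE inE; case: (m v).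
  exact/gradeZ/grade_sqX/ringgen_grade.
have [u hu eu] := augp_exists RG.
have lu := ad_linl (adc_term adc 0) hu.
have := congr1 (fun y : N 0 => @pair 0 R y u) z.
rewrite (klinZ _ lu); last exact/grade_sqX/ringgen_grade.
rewrite (pair_ringgen hu) eu mcoeffX eqxx mulr1 (klin0 lu) => pm.
by rewrite -mcoeff_eq0 pm.
Qed.

(** For a cocycle [w] of degree $R$, [pair R w] vanishes on the kernel of [aug], so it factors
    through the component of the ideal in degree $V\setminus R$. That component has dimension at
    most one, which makes [w] a scalar multiple of $x^R$ times the generator. *)
Lemma cocycles_ringgen (y : N 0) : cocycle y -> exists p : S, y = p *: ringgen.
Proof.
move=> zy; have [s [_ ->]] := hcomp_sum y.
suff hom b : exists p : S, hcomp b y = p *: ringgen.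
  have [p hp] := choice hom; exists (\sum_(b <- undup s) p b).
  by rewrite scaler_suml; apply: eq_bigr => b _.
have [w [hw zw] ->] := cocycle_desc (grade_hcomp b y) (cocycle_hcomp b zy).
set R := supp b in hw *.
suff [p ->] : exists p : S, w = p *: ringgen by exists ('X_[b - sq R] * p); rewrite scalerA.
have lw := ad_linr (adc_term adc 0) hw.
have w0 (u : Y 0) : grade (sq (~: R)) u -> augp u = 0 -> pair R w u = 0.
  move=> hu u0; have /aug_ker[x ex] : aug u = 0 by apply: val_inj.
  have -> : u = cdiff Y (-1) 0 (hcomp (sq (~: R)) x).
    by rewrite (hcomp_lift (@cdiff_grade _ _ Y (-1) 0)) -?ex.
  have := adc_diff adc (i := 0) (j := 1) hw (grade_hcomp (sq (~: R)) x).
  by rewrite zw (klin0 (ad_linl (adc_term adc 1) (grade_hcomp _ x))) => <-.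
have [RG|RG] := boolP (R \in faces G); last first.
  exists 0; rewrite scale0r; apply: (ad_inj (adc_term adc 0) hw) => u hu.
  exact/w0/(augp_face RG hu).
have [u1 hu1 eu1] := augp_exists RG.
exists ((pair R w u1)%:MP * 'X_[sq R]); rewrite -scalerA.
have gX := grade_sqX R ringgen_grade.
apply: (ad_eq (adc_term adc 0) hw) => [|u hu]; first exact: gradeZ.
rewrite (klinZ _ (ad_linl (adc_term adc 0) hu)) // (pair_ringgen hu).
set c := _@_ _; pose u2 : Y 0 := u - c%:MP *: u1.
have hcu : grade (sq (~: R)) (c%:MP *: u1) by apply: gradeZ.
have : pair R w u2 = 0.
  apply: w0; first by apply: gradeD => //; apply: gradeN.
  by rewrite /u2 /augp linearB /= -!/(augp _) augpZ eu1 (augp_grade hu) mul_mpolyC subrr.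
rewrite /u2 (klinB lw) // (klinZ _ lw) // => /eqP; rewrite subr_eq0 => /eqP ->.
by rewrite mulrC.
Qed.

End RingResolution.

Lemma A_resolves_ring (n : nat) (k : fieldType) (G : scomplex n)
    (Y Fv : fsq_complex n k) :
  minimal_free_resolution Y (SR_ideal k (alexander_complex G)) ->
  is_A Y Fv -> minimal_free_resolution Fv (SR_ring k G).
Proof.
move=> [_ [Y0 [Yex [aug [ag asurj aker]]]]] [mF [N [pair [phi [adc phiP phiQ]]]]].
have cphi : chain_map phi := cmor_comm phiP.
have qphi := (quasi_isoP phi).1 phiQ.
have Nneg i : i < 0 -> forall y : N i, y = 0.
  by move=> i0; apply: (ad_zero adc); apply: Y0; rewrite oppr_gt0.
have Nex i (y : N i) : i != 0 -> cocycle y -> coboundary y.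
  rewrite neq_lt => /orP[i0 _|i0]; first by rewrite (Nneg i i0 y); apply: coboundary0.
  apply: (ad_exact adc) => u hu.
  have [|w ->] := Yex (- i) _ u (hu _); first by rewrite oppr_lt0.
  by exists (- i - 1), w.
have Fex i (u : Fv i) : i != 0 -> cocycle u -> coboundary u.
  move=> i0 hu; apply: (qphi i).1 => //.
  by apply: Nex => //; apply: chain_map_cocycle.
have Fpos := minimal_exact_pos mF (fun i u i0 => @Fex i u (lt0r_neq0 i0)).
split => //; split => //; split.
  move=> i i0 u hu; have e : i = (i - 1) + 1 by rewrite subrK.
  by apply: (coboundaryP e); apply: Fex; [rewrite lt_eqF|apply: cocycleP hu].
have Fcyc (u : Fv 0) : cocycle u.
  by apply: (@cocycleP _ _ _ _ 1) => //; apply: Fpos.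
pose x := ringgen adc aug.
(* Since [N] vanishes in negative degrees, its cohomology in degree 0 is the module of cocycles
   $S\cdot x$, isomorphic to $k[\Gamma]$. *)
have N0 (y : N 0) : coboundary y -> y = 0.
  move=> /(coboundaryP (erefl : 0 = -1 + 1 :> int))[w ->].
  by rewrite (@Nneg (-1) _ w) ?linear0.
have ann (p : {mpoly k[n]}) : p *: x = 0 <-> (p : {mpoly k[n]}^o) \in @in_SR_ideal n k G.
  exact: (annihilator_ringgen adc ag asurj).
have rep (u : Fv 0) : exists p : {mpoly k[n]}, phi 0 u = p *: x.
  by apply: (cocycles_ringgen adc ag asurj aker); apply: chain_map_cocycle.
have [p hp] := choice rep.
have pi_eq (q r : {mpoly k[n]}) : q *: x = r *: x ->
    SR_pi G (q : {mpoly k[n]}^o) = SR_pi G (r : {mpoly k[n]}^o).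
  by move=> e; apply/SR_pi_eq/ann; rewrite scalerBl e subrr.
(* The coefficient [p u] comes from choice and need not be linear in [u]; modulo the annihilator of
   [x] it is. *)
pose f (u : Fv 0) : SR_ring k G := SR_pi G (p u : {mpoly k[n]}^o).
have f_lin : linear f.
  move=> a u v; rewrite /f -[RHS]linearP; apply: pi_eq.
  by rewrite -hp linearP !hp scalerDl scalerA.
pose fL : {linear Fv 0 -> SR_ring k G} :=
  HB.pack f (GRing.isLinear.Build _ _ _ _ f f_lin).
exists fL; split.
(* [p u] need not be homogeneous, but as [phi 0 u] has degree [b], the term of degree [b] of [p u]
   yields the same multiple of [x]. *)
- move=> b u hu; exists ((p u)@_b *: 'X_[b]); split.
    move=> m /msuppZ_le; rewrite msuppX inE => /eqP ->; by rewrite sq0 addm0.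
  apply: pi_eq; rewrite -hp.
  have := hcomp_id b (cmor_grade phiP hu); rewrite eqxx => <-.
  rewrite hp hcomp_scale; last by rewrite -sq0; apply: ringgen_grade.
  by rewrite scalerA mul_mpolyC.
- move=> y; have [q eq] : exists q : {mpoly k[n]}^o, y = SR_pi G q.
    by exists (repr (y : SR_quot k G)); rewrite SR_pi_repr.
  have zq : cocycle (q *: x) by move=> j; rewrite linearZ /= ringgen_cocycle ?scaler0.
  have [u _ /N0/eqP hu] := (qphi 0).2 _ zq; exists u; rewrite eq.
  by apply: pi_eq; rewrite -hp; apply/eqP; rewrite -subr_eq0.
- move=> u; split => [fu0|[w ->]].
    apply: (coboundaryP (erefl : 0 = -1 + 1 :> int)); apply: (qphi 0).1 => //.
    rewrite hp (_ : p u *: x = 0); first exact: coboundary0.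
    by apply/ann; rewrite -[X in X \in _]subr0; apply/SR_pi_eq; rewrite linear0.
  rewrite /= /f -(linear0 (SR_pi G)); apply: pi_eq; rewrite scale0r -hp.
  by apply: N0; rewrite cphi; exists (-1), (phi (-1) w).
Qed.

(* Q stands for A(E[-1]), D Q for G = D(A(E[-1])), and Fv for A(G); A(-) is
   only defined up to isomorphism, so all its models are quantified over. *)
Theorem corollary4p5 (n : nat) (k : fieldType) (Gamma : scomplex n)
    (vertices : forall v : 'I_n, [set v] \in faces Gamma)
    (Q Fv : fsq_complex n k) :
  is_A (chain_shift (enriched k Gamma)) Q ->
  is_A (D Q) Fv ->
  minimal_free_resolution Fv (SR_ring k Gamma) /\
  minimal_free_resolution (D Q) (SR_ideal k (alexander_complex Gamma)).
Proof.
move=> hQ hFv; have hD := D_resolves_ideal hQ.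
by split => //; apply: A_resolves_ring hD hFv.
Qed.
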